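(* Let $p$ be a prime and let $n\ge2$. Then $$H^2\Bigl(GL(n,\mathbb{Z}_{p^r});\,H^{2p^n-3}\bigl(\textstyle\bigoplus_n\mathbb{Z}_{p^r};\mathbb{F}_p\bigr)\Bigr)\neq0$$ if $p=2$ and $r\ge3$, or if $p$ is odd and $r\ge2$, where the action of $GL(n,\mathbb{Z}_{p^r})$ on $H^{2p^n-3}\bigl(\bigoplus_n\mathbb{Z}_{p^r};\mathbb{F}_p\bigr)$ is induced by the natural action of $GL(n,\mathbb{Z}_{p^r})$ on $\bigoplus_n\mathbb{Z}_{p^r}$.
   Context: $\mathbb{Z}_{p^r}$ is the cyclic group (ring) $\mathbb{Z}/p^r$, and $\bigoplus_n\mathbb{Z}_{p^r}$ is the direct sum of $n$ copies. *)

(* Defs.v *)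
From HB Require Import structures.
From mathcomp Require Import all_boot all_order all_algebra all_fingroup.
From mathcomp Require Import boolp generic_quotient.

Set Implicit Arguments.
Unset Strict Implicit.
Unset Printing Implicit Defensive.

Import GRing.Theory.
Local Open Scope ring_scope.
Local Open Scope quotient_scope.

Record gmodule (G : finGroupType) := GModule {
  gmod_sort :> zmodType;
  gmod_act : G -> gmod_sort -> gmod_sort;
  gmod_actB : forall g, {morph gmod_act g : x y / x - y};
  gmod_act1 : forall x, gmod_act 1%g x = x;
  gmod_actM : forall g h x, gmod_act (g * h)%g x = gmod_act g (gmod_act h x)
}.

Section Cohomology.
Variables (G : finGroupType) (M : gmodule G).

(* Inhomogeneous (bar) cochains. *)
Definition cochain (k : nat) : zmodType := {ffun {ffun 'I_k -> G} -> M}.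

(* (g_0, ..., g_k) |-> (g_0, ..., g_i g_(i+1), ..., g_k) *)
Definition bar_merge k (i : 'I_k) (x : {ffun 'I_k.+1 -> G}) : {ffun 'I_k -> G} :=
  [ffun j : 'I_k =>
     if (j < i)%N then x (widen_ord (leqnSn k) j)
     else if j == i then (x (widen_ord (leqnSn k) j) * x (lift ord0 j))%g
     else x (lift ord0 j)].

Definition coboundary k (c : cochain k) : cochain k.+1 :=
  [ffun x : {ffun 'I_k.+1 -> G} =>
     gmod_act (x ord0) (c [ffun j : 'I_k => x (lift ord0 j)])
     + \sum_(i < k) c (bar_merge i x) *~ (-1) ^+ i.+1
     + c [ffun j : 'I_k => x (widen_ord (leqnSn k) j)] *~ (-1) ^+ k.+1].

Lemma coboundaryB k : {morph @coboundary k : c c' / c - c'}.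
Proof.
move=> c c'; apply/ffunP=> x; rewrite !ffunE gmod_actB.
under eq_bigr do rewrite !ffunE mulrzBl.
rewrite sumrB mulrzBl !opprD [RHS]addrACA; congr (_ + _).
by rewrite [RHS]addrACA.
Qed.

Definition is_cocycle (k : nat) : {pred cochain k} := fun c => coboundary c == 0.
Arguments is_cocycle : clear implicits.

Fact is_cocycle_zmod_closed k : zmod_closed (is_cocycle k).
Proof.
have d0 : @coboundary k 0 = 0 by rewrite -(subrr 0) coboundaryB subrr.
split=> [|c c' /eqP dc /eqP dc']; first exact/eqP.
by apply/eqP; rewrite coboundaryB dc dc' subrr.
Qed.
HB.instance Definition _ k :=
  GRing.isZmodClosed.Build (cochain k) (is_cocycle k) (@is_cocycle_zmod_closed k).

Record cocycle k := Cocycle { cocycle_val :> cochain k;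
                              _ : cocycle_val \in is_cocycle k }.
HB.instance Definition _ k := [isSub for @cocycle_val k].
HB.instance Definition _ k := [Choice of cocycle k by <:].
HB.instance Definition _ k := [SubChoice_isSubZmodule of cocycle k by <:].

Definition is_coboundary k : cochain k -> Prop :=
  match k with
  | 0 => fun c => c = 0
  | k'.+1 => fun c => exists b : cochain k', c = coboundary b
  end.

Definition coboundaries k : {pred cocycle k} := fun z => `[< is_coboundary (val z) >].
Arguments coboundaries : clear implicits.

Fact coboundaries_zmod_closed k : zmod_closed (coboundaries k).
Proof.
have dN : forall j (c c' : cochain j), is_coboundary c -> is_coboundary c' ->
    is_coboundary (c - c').
  case=> [|j] c c' /=; first by move=> -> ->; rewrite subrr.
  by move=> [b ->] [b' ->]; exists (b - b'); rewrite coboundaryB.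
split=> [|u v /asboolP Bu /asboolP Bv]; apply/asboolP.
  case: k => [|k] //=; exists 0.
  by rewrite -[X in coboundary X](subrr 0) coboundaryB subrr.
by rewrite raddfB; apply: dN.
Qed.
HB.instance Definition _ k :=
  GRing.isZmodClosed.Build (cocycle k) (coboundaries k)
    (@coboundaries_zmod_closed k).

Definition cohomology k : zmodType := Quotient.quot (coboundaries k).

End Cohomology.

Arguments is_cocycle {G} M k.
Arguments coboundaries {G} M k.
Arguments cohomology {G} M k.

Definition trivial_gmodule (G : finGroupType) (A : zmodType) : gmodule G :=
  @GModule G A (fun _ x => x) (fun _ _ _ => erefl) (fun _ => erefl)
    (fun _ _ _ => erefl).

Section Functoriality.
Variables (A : zmodType).

Section Pullback.
Variables (G H : finGroupType) (f : {multiplicative G -> H}).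
Notation TG := (trivial_gmodule G A).
Notation TH := (trivial_gmodule H A).

Definition cochain_pull k (c : cochain TH k) : cochain TG k :=
  [ffun x : {ffun 'I_k -> G} => c [ffun j => f (x j)]].

Lemma cochain_pullB k : {morph @cochain_pull k : c c' / c - c'}.
Proof. by move=> c c'; apply/ffunP=> x; rewrite !ffunE. Qed.

Lemma cochain_pull_coboundary k (c : cochain TH k) :
  cochain_pull (coboundary c) = coboundary (cochain_pull c).
Proof.
apply/ffunP=> x; rewrite !ffunE /=; congr (_ + _ + _).
- by congr (c _); apply/ffunP=> j; rewrite !ffunE.
- apply: eq_bigr => i _; rewrite ffunE; congr (c _ *~ _).
  apply/ffunP=> j; rewrite !ffunE.
  by case: ifP => // _; case: ifP => // _; rewrite gmulfM.
- by congr (c _ *~ _); apply/ffunP=> j; rewrite !ffunE.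
Qed.

Fact cocycle_pull_subproof k (z : cocycle TH k) :
  cochain_pull (val z) \in is_cocycle TG k.
Proof.
apply/eqP; rewrite -cochain_pull_coboundary (eqP (valP z)).
by apply/ffunP=> x; rewrite !ffunE.
Qed.

Definition cocycle_pull k (z : cocycle TH k) : cocycle TG k :=
  Cocycle (cocycle_pull_subproof z).

Lemma cocycle_pullB k : {morph @cocycle_pull k : z z' / z - z'}.
Proof.
move=> z z'; apply: val_inj; rewrite [RHS]raddfB -[RHS]cochain_pullB.
by congr cochain_pull; rewrite -raddfB.
Qed.

Lemma cocycle_pull_boundary k (z : cocycle TH k) :
  z \in coboundaries TH k -> cocycle_pull z \in coboundaries TG k.
Proof.
move=> /asboolP Bz; apply/asboolP; move: Bz; rewrite /=.
move: (cocycle_val z); case: k {z} => [|k] c /=.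
  by move=> ->; apply/ffunP=> x; rewrite !ffunE.
by move=> [b ->]; exists (cochain_pull b); rewrite cochain_pull_coboundary.
Qed.

Definition cohomology_pull k (x : cohomology TH k) : cohomology TG k :=
  \pi_(cohomology TG k) (cocycle_pull (repr x)).

Lemma cohomology_pull_pi k (z : cocycle TH k) :
  cohomology_pull (\pi_(cohomology TH k) z) =
  \pi_(cohomology TG k) (cocycle_pull z).
Proof.
apply/eqP; rewrite /cohomology_pull -Quotient.idealrBE -cocycle_pullB.
by apply: cocycle_pull_boundary; rewrite Quotient.idealrBE reprK.
Qed.

Lemma cohomology_pullB k : {morph @cohomology_pull k : x y / x - y}.
Proof.
move=> x y; rewrite -[x]reprK -[y]reprK -raddfB !cohomology_pull_pi.
by rewrite cocycle_pullB raddfB.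
Qed.

End Pullback.

Lemma cohomology_pull_id (G : finGroupType) (f : {multiplicative G -> G}) k :
  f =1 id -> @cohomology_pull G G f k =1 id.
Proof.
move=> f1 x; rewrite -[x in RHS]reprK; congr (\pi _).
apply/val_inj/ffunP=> y; rewrite /= ffunE; congr (fun_of_fin _ _).
by apply/ffunP=> j; rewrite ffunE f1.
Qed.

Lemma cohomology_pull_comp (G H K : finGroupType) (f : {multiplicative G -> H})
    (f' : {multiplicative H -> K}) (f'' : {multiplicative G -> K}) k x :
  f'' =1 f' \o f ->
  @cohomology_pull G K f'' k x = cohomology_pull f (cohomology_pull f' x).
Proof.
move=> fE; rewrite [RHS]cohomology_pull_pi; congr (\pi _).
apply/val_inj/ffunP=> y; rewrite /= !ffunE; congr (fun_of_fin _ _).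
by apply/ffunP=> j; rewrite !ffunE fE.
Qed.

End Functoriality.

Section NaturalAction.
Variables (R : finComUnitRingType) (n : nat).

(* {'GL_n[R]} consists of matrices of size n.-1.+1, which is n as soon as 0 < n;
   the group law of the finGroupType 'cV[R]_m is addition. *)
Definition GL_vec : finGroupType := 'cV[R]_(n.-1.+1).

Definition GL_mulv (g : {'GL_n[R]}) (v : GL_vec) : GL_vec := GLval g *m v.

Fact GL_mulvM g : {morph GL_mulv g : u v / (u * v)%g}.
Proof. by move=> u v; apply: (mulmxDr (GLval g) u v). Qed.
HB.instance Definition _ g :=
  isMultiplicative.Build GL_vec GL_vec (GL_mulv g) (GL_mulvM g).

Variables (A : zmodType) (k : nat).

Definition GL_gact (g : {'GL_n[R]})
    (x : cohomology (trivial_gmodule GL_vec A) k) :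
    cohomology (trivial_gmodule GL_vec A) k :=
  cohomology_pull (GL_mulv g^-1%g) x.

Fact GL_gact1 x : GL_gact 1%g x = x.
Proof.
by apply: cohomology_pull_id => v; rewrite /GL_mulv invg1; apply: mul1mx.
Qed.

Fact GL_gactM g h x : GL_gact (g * h)%g x = GL_gact g (GL_gact h x).
Proof.
by apply: cohomology_pull_comp => v; rewrite /GL_mulv invMg; apply/esym; apply: mulmxA.
Qed.

(* The inverse turns the contravariant functoriality of H^k(-; A) into a left
   action. *)
Definition GL_cohomology : gmodule {'GL_n[R]} :=
  @GModule {'GL_n[R]} (cohomology (trivial_gmodule GL_vec A) k) GL_gact
    (fun g => @cohomology_pullB A GL_vec GL_vec (GL_mulv g^-1%g) k)
    GL_gact1 GL_gactM.

End NaturalAction.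

(* Main.v *)
Require Import Defs.
From mathcomp Require Import all_boot all_order all_algebra all_fingroup.
From HB Require Import structures.
From mathcomp Require Import boolp generic_quotient ring zify.

(**
Write q = p^r, G = GL(n, Z/q), V = (Z/q)^n, and let c be the product of all the nonzero linear
forms over F_p in the Bockstein classes y_1, ..., y_n in H^2(V; F_p), i.e. the top Dickson
invariant. A matrix E over F_p defines a derivation y_i |-> sum_j E_ij x_j, where the x_j span
Hom(V, F_p) inside H^1, and E |-> E(c) is a G-equivariant map from M_n(F_p) to
H^(2p^n-3)(V; F_p). The witness is the image under this map of the class in H^2(G; M_n(F_p)) of
the extension M_n(F_p) -> GL(n, Z/p^(r+1)) -> G.

It is detected on the cyclic group of order p generated by the elementary matrix
g = 1 + p^(r-1) e_(n,1): summing the extension cocycle over the pairs (g^j, g) gives e_(n,1), so if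
the image were a coboundary then e_(n,1)(c) = x_1 dc/dy_n would lie in the image of 1 + g + ... +
g^(p-1) and be killed by every g-invariant linear functional. The functional used is evaluation on
a shuffle product of cycles, one for each of p e_1, e_2, ..., e_n (all fixed by g) and the
1-cycle [e_1], whose class g fixes because [v] is additive in v and g e_1 - e_1 is divisible by p.
It extracts from x_1 dc/dy_n the coefficient of x_1 times the leading monomial of c divided by y_n,
which is nonzero.
*)

Set Implicit Arguments.
Unset Strict Implicit.
Unset Printing Implicit Defensive.

Import GRing.Theory Num.Theory.
Local Open Scope ring_scope.
Local Open Scope quotient_scope.

(** * Inhomogeneous cochains as functions on sequences *)

Section SeqCochains.
Variables (L : finGroupType) (F : comNzRingType).
Implicit Types (U V W f g : seq L -> F) (s : seq L).

(* The alternating sum of the bar faces of [s] except the first one, the last one included: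
   the recursion on prefixes is what both [cup] and [chain_eval] are compatible with. *)
Fixpoint inner_faces U s : F :=
  match s with
  | [::] => 0
  | a :: s' =>
    match s' with
    | [::] => U [::]
    | b :: s'' => U ((a * b)%g :: s'') - inner_faces (fun l => U (a :: l)) s'
    end
  end.

(** The bar coboundary for trivial coefficients; [coboundary_to_cochain] below identifies it with
    [coboundary]. *)
Definition scob U s : F := U (behead s) - inner_faces U s.

Lemma inner_faces_cons U a b s :
  inner_faces U [:: a, b & s] =
  U ((a * b)%g :: s) - inner_faces (fun l => U (a :: l)) (b :: s).
Proof. by []. Qed.

Lemma eq_inner_faces U V s :
  (forall l, size l = (size s).-1 -> U l = V l) -> inner_faces U s = inner_faces V s.
Proof.
elim: s U V => [//|a [|b s] IH] U V eqUV; first exact: eqUV.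
rewrite !inner_faces_cons eqUV //; congr (_ - _).
by apply: IH => l szl; apply: eqUV; rewrite /= szl.
Qed.

Lemma eq_scob U V s :
  (forall l, size l = (size s).-1 -> U l = V l) -> scob U s = scob V s.
Proof.
by move=> eqUV; rewrite /scob (eq_inner_faces eqUV) eqUV // size_behead.
Qed.

Lemma inner_facesB U V s :
  inner_faces (fun l => U l - V l) s = inner_faces U s - inner_faces V s.
Proof.
elim: s U V => [|a [|b s] IH] U V; rewrite ?subr0 // !inner_faces_cons IH; ring.
Qed.

Lemma inner_faces0 s : inner_faces (fun=> 0) s = 0.
Proof. by elim: s => [|a [|b s] IH] //; rewrite inner_faces_cons IH subr0. Qed.

Lemma scobB U V s : scob (fun l => U l - V l) s = scob U s - scob V s.
Proof. by rewrite /scob inner_facesB; ring. Qed.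

Lemma scob0 s : scob (fun=> 0) s = 0.
Proof. by rewrite /scob inner_faces0 subr0. Qed.

Lemma scobN U s : scob (fun l => - U l) s = - scob U s.
Proof.
have := scobB (fun=> 0) U s; rewrite scob0 sub0r => <-.
by apply: eq_scob => l _; rewrite sub0r.
Qed.

Lemma scobD U V s : scob (fun l => U l + V l) s = scob U s + scob V s.
Proof.
rewrite -[scob V s]opprK -scobN -scobB.
by apply: eq_scob => l _; rewrite opprK.
Qed.

(** The Alexander-Whitney product without a sign, where [k] is the degree of the left factor. The
    value 0 on sequences shorter than [k] is a default. *)
Fixpoint cup (k : nat) f g s : F :=
  match k, s with
  | 0, _ => f [::] * g s
  | k'.+1, a :: s' => cup k' (fun l => f (a :: l)) g s'
  | _, [::] => 0
  end.

Lemma eq_cup k f f' g g' s : (k <= size s)%N ->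
  (forall l, size l = k -> f l = f' l) ->
  (forall l, size l = (size s - k)%N -> g l = g' l) ->
  cup k f g s = cup k f' g' s.
Proof.
elim: k f f' s => [|k IH] f f' s /= lek eqf eqg.
  by rewrite eqf // eqg // subn0.
case: s lek eqg => [//|a s] /= lek eqg.
by apply: IH => // l szl; apply: eqf; rewrite /= szl.
Qed.

Lemma cupBl k f f' g s :
  cup k (fun l => f l - f' l) g s = cup k f g s - cup k f' g s.
Proof.
elim: k f f' s => [|k IH] f f' [|a s] /=; by rewrite ?mulrBl ?subr0.
Qed.

Lemma cupBr k f g g' s :
  cup k f (fun l => g l - g' l) s = cup k f g s - cup k f g' s.
Proof.
elim: k f s => [|k IH] f [|a s] /=; by rewrite ?mulrBr ?subr0.
Qed.

Lemma cup0l k g s : cup k (fun=> 0) g s = 0.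
Proof. by elim: k s => [|k IH] [|a s] //=; rewrite ?mul0r. Qed.

Lemma cup0r k f s : cup k f (fun=> 0) s = 0.
Proof. by elim: k f s => [|k IH] f [|a s] //=; rewrite ?mulr0. Qed.

Lemma cupA k l f g h s : (k + l <= size s)%N ->
  cup k f (cup l g h) s = cup (k + l) (cup k f g) h s.
Proof.
elim: k f s => [|k IH] f [|a s] //= ; last by rewrite ltnS; apply: IH.
- by case: l => [|l] //=; rewrite mulrA.
- rewrite add0n; elim: l g a s => [|l IHl] g a s /=; first by rewrite mulrA.
  rewrite ltnS; case: s => [|b s]; last exact: IHl.
  by case: l {IHl} => //= _; rewrite mulrA.
Qed.

(** The last face of the first k+1 entries and the first face of the remaining ones give the same
    product with opposite signs. This cancellation is what makes the Leibniz rule [scob_cup]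
    hold. *)
Lemma inner_faces_cup k f g s : (k < size s)%N ->
  inner_faces (cup k f g) s =
  cup k.+1 (inner_faces f) g s - (-1) ^+ k * cup k f (scob g) s.
Proof.
elim: k f s => [|k IH] f [//|a s] lek.
  rewrite expr0 mul1r /scob.
  have -> : inner_faces (cup 0 f g) (a :: s) = f [::] * inner_faces g (a :: s).
    elim: s a g {lek} => [|b s IH] a g; first by rewrite /=.
    by rewrite !inner_faces_cons mulrBr -IH.
  by rewrite /=; ring.
case: s lek => [//|b s] lek.
rewrite inner_faces_cons IH //= exprS cupBl; ring.
Qed.

Lemma scob_cup k f g s : (k < size s)%N ->
  scob (cup k f g) s = cup k.+1 (scob f) g s + (-1) ^+ k * cup k f (scob g) s.
Proof.
move=> lek; rewrite /scob inner_faces_cup // cupBl.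
have -> : cup k f g (behead s) = cup k.+1 (fun l => f (behead l)) g s.
  by case: s lek => [|a s].
by rewrite /scob; ring.
Qed.

Definition scocycle k U := forall s, size s = k.+1 -> scob U s = 0.
Definition cohomologous k U V :=
  exists W, forall s, size s = k -> U s - V s = scob W s.

Lemma cohomologous_refl k U V : (forall s, size s = k -> U s = V s) ->
  cohomologous k U V.
Proof. by move=> eqUV; exists (fun=> 0) => s szs; rewrite eqUV // subrr scob0. Qed.

Lemma cohomologous_sym k U V : cohomologous k U V -> cohomologous k V U.
Proof.
by case=> W UV; exists (fun l => - W l) => s szs; rewrite scobN -UV // opprB.
Qed.

Lemma cohomologous_trans k U V W :
  cohomologous k U V -> cohomologous k V W -> cohomologous k U W.
Proof.
case=> A UV [B VW]; exists (fun l => A l + B l) => s szs.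
by rewrite scobD -UV // -VW // addrA subrK.
Qed.

Lemma scocycle_cup k l f g :
  scocycle k f -> scocycle l g -> scocycle (k + l) (cup k f g).
Proof.
move=> cf cg s szs; rewrite scob_cup ?szs ?ltnS ?leq_addr //.
rewrite (@eq_cup k.+1 _ (fun=> 0) _ g) ?szs ?ltnS ?leq_addr //.
rewrite cup0l add0r (@eq_cup k _ f _ (fun=> 0)) ?szs ?cup0r ?mulr0 //.
  by apply: leq_trans (leq_addr l k) _; apply: leqnSn.
by move=> t szt; apply: cg; rewrite szt -addnS addKn.
Qed.

Arguments scocycle_cup [k l f g] _ _ s _.

Lemma cohomologous_cupl k l f f' g : scocycle l g ->
  cohomologous k.+1 f f' -> cohomologous (k.+1 + l) (cup k.+1 f g) (cup k.+1 f' g).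
Proof.
move=> cg [W fW]; exists (cup k W g) => s szs.
have le1 : (k.+1 <= size s)%N by rewrite szs leq_addr.
rewrite -cupBl scob_cup //.
rewrite [X in _ + _ * X](_ : _ = 0) ?mulr0 ?addr0; first exact: eq_cup.
rewrite (@eq_cup k _ W _ (fun=> 0)) ?cup0r //; first exact: ltnW.
by move=> t szt; apply: cg; rewrite szt szs addSnnS addKn.
Qed.

Lemma cohomologous_cupr k l f g g' : scocycle k f ->
  cohomologous l.+1 g g' -> cohomologous (k + l.+1) (cup k f g) (cup k f g').
Proof.
move=> cf [W gW]; exists (fun s => (-1) ^+ k * cup k f W s) => s szs.
have le1 : (k < size s)%N by rewrite szs addnS ltnS leq_addr.
have -> : scob (fun s => (-1) ^+ k * cup k f W s) s = (-1) ^+ k * scob (cup k f W) s.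
  rewrite -signr_odd; case: odd; rewrite ?expr0 ?expr1 ?mulN1r ?mul1r.
    by rewrite -scobN; apply: eq_scob => t _; rewrite mulN1r.
  by apply: eq_scob => t _; rewrite mul1r.
rewrite -cupBr scob_cup // (@eq_cup k.+1 _ (fun=> 0) _ W) // cup0l add0r.
rewrite mulrA -expr2 sqrr_sign mul1r.
apply: eq_cup => //; first exact: ltnW.
by move=> t szt; apply: gW; rewrite szt szs addKn.
Qed.

(* The homotopy is the cup-1 product of [b] and [a]. *)
Lemma cohomologous_cupC22 a b : scocycle 2 a -> scocycle 2 b ->
  cohomologous 4 (cup 2 a b) (cup 2 b a).
Proof.
move=> ca cb.
pose c s := if s is [:: x; y; z] then
  b [:: (x * y)%g; z] * a [:: x; y] - b [:: x; (y * z)%g] * a [:: y; z] else 0.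
exists c => -[|x [|y [|z [|t [|u s]]]]] //= _.
have E u : scocycle 2 u -> forall x y z, u [:: y; z] - (u [:: (x * y)%g; z] -
  (u [:: x; (y * z)%g] - u [:: x; y])) = 0.
  by move=> cu x' y' z'; apply: (cu [:: x'; y'; z']).
rewrite /scob /= !mulgA.
have Eb1 := E b cb x y (z * t)%g; have Eb2 := E b cb (x * y)%g z t.
have Eb3 := E b cb x (y * z)%g t.
have Ea1 := E a ca x y z; have Ea2 := E a ca y z t.
rewrite !mulgA in Eb1 Eb2 Eb3 Ea1 Ea2.
have comb0 (c1 c2 c3 c4 c5 e1 e2 e3 e4 e5 u v : F) :
    e1 = 0 -> e2 = 0 -> e3 = 0 -> e4 = 0 -> e5 = 0 ->
    v = u + (c1 * e1 + c2 * e2 + c3 * e3 + c4 * e4 + c5 * e5) -> u = v.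
  by do 5!move=> ->; rewrite !mulr0 !addr0 => ->.
(* Two cocycle identities of [a], weighted by values of [b], and three of [b], weighted by values of
   [a], account for the whole difference. *)
apply: (comb0 (b [:: (x * y * z)%g; t]) (b [:: x; (y * z * t)%g])
  (- a [:: z; t]) (- a [:: x; y]) (a [:: y; z]) _ _ _ _ _ _ _ Ea1 Ea2 Eb1 Eb2 Eb3).
ring.
Qed.

End SeqCochains.

(** * Products of a degree-one cocycle with degree-two cocycles *)

Section CupMonomials.
Variables (L : finGroupType) (F : comNzRingType) (I : eqType).
Implicit Types (x : seq L -> F) (Y : I -> seq L -> F) (ms : seq I).

Definition cups Y ms : seq L -> F := foldr (fun m => cup 2 (Y m)) (fun=> 1) ms.
Definition cup_monomial x Y ms : seq L -> F := cup 1 x (cups Y ms).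

Lemma scocycle_cups Y ms : (forall m, scocycle 2 (Y m)) ->
  scocycle (size ms).*2 (cups Y ms).
Proof.
move=> cY; elim: ms => [|m ms IH]; last exact: scocycle_cup (cY m) IH.
by case=> [|a [|b s]] //= _; rewrite /scob /= subrr.
Qed.

Arguments scocycle_cups [Y] ms _ s _.

Lemma scocycle_cup_monomial x Y ms : scocycle 1 x -> (forall m, scocycle 2 (Y m)) ->
  scocycle (size ms).*2.+1 (cup_monomial x Y ms).
Proof. by move=> cx cY; apply: scocycle_cup cx (scocycle_cups ms cY). Qed.

Lemma cohomologous_cups_swap Y a b ms : (forall m, scocycle 2 (Y m)) ->
  cohomologous (size ms).*2.+4 (cups Y [:: a, b & ms]) (cups Y [:: b, a & ms]).
Proof.
move=> cY.
have E u v : cohomologous (size ms).*2.+4 (cups Y [:: u, v & ms])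
    (cup 4 (cup 2 (Y u) (Y v)) (cups Y ms)).
  by apply: cohomologous_refl => s szs; apply: (@cupA _ _ 2 2); rewrite szs.
apply: cohomologous_trans (E a b) _.
apply: cohomologous_trans (cohomologous_sym (E b a)).
exact: cohomologous_cupl (scocycle_cups ms cY) (cohomologous_cupC22 (cY a) (cY b)).
Qed.

Lemma cohomologous_cups_move Y a ms1 ms2 : (forall m, scocycle 2 (Y m)) ->
  cohomologous (size (a :: ms1 ++ ms2)).*2 (cups Y (a :: ms1 ++ ms2))
    (cups Y (ms1 ++ a :: ms2)).
Proof.
move=> cY; elim: ms1 => [|b ms1 IH]; first exact: cohomologous_refl.
apply: cohomologous_trans (cohomologous_cups_swap a b _ cY) _.
exact: cohomologous_cupr (cY b) IH.
Qed.

(** Needed because a group element permutes the linear forms, so that the factors of the Dickson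
    product come back in another order. *)
Lemma cohomologous_cups_perm Y ms ms' : (forall m, scocycle 2 (Y m)) ->
  perm_eq ms ms' -> cohomologous (size ms).*2 (cups Y ms) (cups Y ms').
Proof.
move=> cY; elim: ms ms' => [|m ms IH] ms' pe.
  by move: pe; rewrite perm_sym => /perm_nilP ->; apply: cohomologous_refl.
have m_in : m \in ms' by rewrite -(perm_mem pe) mem_head.
case/splitPr: m_in pe => s1 s2; rewrite perm_sym -[m :: s2]cat1s perm_catCA /= perm_cons perm_sym => pe.
apply: cohomologous_trans (_ : cohomologous _ (cups Y (m :: s1 ++ s2)) _); last first.
  by rewrite /= (perm_size pe); apply: cohomologous_cups_move.
(* [cohomologous_cupr] asks for a right factor of positive degree, so an empty tail is treated
   apart. *)
case: ms IH pe => [|m' ms] IH pe; last exact: cohomologous_cupr (cY m) (IH _ pe).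
by move: pe; rewrite perm_sym => /perm_nilP ->; apply: cohomologous_refl.
Qed.

Lemma cohomologous_cups Y Y' ms : (forall m, scocycle 2 (Y m)) ->
    (forall m, scocycle 2 (Y' m)) -> (forall m, cohomologous 2 (Y m) (Y' m)) ->
  cohomologous (size ms).*2 (cups Y ms) (cups Y' ms).
Proof.
move=> cY cY' YY'; elim: ms => [|m ms IH]; first exact: cohomologous_refl.
apply: cohomologous_trans (cohomologous_cupl (scocycle_cups ms cY) (YY' m)) _.
case: ms IH => [|m' ms] IH; first exact: cohomologous_refl.
exact: cohomologous_cupr (cY' m) IH.
Qed.

Lemma cohomologous_cup_monomial_perm x Y ms ms' :
    scocycle 1 x -> (forall m, scocycle 2 (Y m)) -> perm_eq ms ms' ->
  cohomologous (size ms).*2.+1 (cup_monomial x Y ms) (cup_monomial x Y ms').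
Proof.
move=> cx cY pe; have := cohomologous_cups_perm cY pe.
case: ms pe => [|m ms] pe; last by move=> H; exact: cohomologous_cupr cx H.
by move: pe; rewrite perm_sym => /perm_nilP -> _; apply: cohomologous_refl.
Qed.

Lemma cohomologous_cup_monomial x Y Y' ms :
    scocycle 1 x -> (forall m, scocycle 2 (Y m)) ->
    (forall m, scocycle 2 (Y' m)) -> (forall m, cohomologous 2 (Y m) (Y' m)) ->
  cohomologous (size ms).*2.+1 (cup_monomial x Y ms) (cup_monomial x Y' ms).
Proof.
move=> cx cY cY' YY'; have := cohomologous_cups ms cY cY' YY'.
case: ms => [|m ms]; last by move=> H; exact: cohomologous_cupr cx H.
by move=> _; apply: cohomologous_refl.
Qed.

Lemma cup_monomialDl x x' Y ms s :
  cup_monomial (fun l => x l + x' l) Y ms s =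
  cup_monomial x Y ms s + cup_monomial x' Y ms s.
Proof. by rewrite /cup_monomial; case: s => [|a s] /=; rewrite ?addr0 // mulrDl. Qed.

End CupMonomials.

Lemma eq_cups (L : finGroupType) (F : comNzRingType) (I J : eqType)
    (Y : I -> seq L -> F) (Y' : J -> seq L -> F) (f : I -> J) ms :
    (forall m s, Y m s = Y' (f m) s) ->
  forall s, size s = (size ms).*2 -> cups Y ms s = cups Y' (map f ms) s.
Proof.
move=> YY'; elim: ms => [//|m ms IH] s szs.
apply: (@eq_cup _ _ 2) => [|l _|l szl]; first by rewrite szs.
- exact: YY'.
- by apply: IH; rewrite szl szs /= doubleS subn2.
Qed.

Lemma cup_map (L L' : finGroupType) (F : comNzRingType) (g : L -> L') k
    (f h : seq L' -> F) s :
  cup k f h (map g s) = cup k (f \o map g) (h \o map g) s.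
Proof. by elim: k f s => [|k IH] f [|a s] //=; rewrite IH. Qed.

Lemma cup_monomial_map (L L' : finGroupType) (F : comNzRingType) (I : eqType)
    (g : L -> L') x (Y : I -> seq L' -> F) ms s :
  cup_monomial x Y ms (map g s) =
  cup_monomial (x \o map g) (fun m => Y m \o map g) ms s.
Proof.
rewrite /cup_monomial cup_map; case: s => [//|a s] /=; congr (_ * _).
elim: ms s => [//|m ms IH] [|b [|c s]] //=.
by congr (_ * _); apply: IH.
Qed.

(** * Classes of sequence cochains in the bar cohomology, and functionals on classes *)

Section BarClasses.
Variables (L : finGroupType) (F : comNzRingType).
Notation TL := (trivial_gmodule L F).
Implicit Types (U V : seq L -> F).

Definition to_cochain k U : cochain TL k :=
  [ffun x : {ffun 'I_k -> L} => U (codom x)].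

Lemma codom_ffunS (T : Type) k (x : {ffun 'I_k.+1 -> T}) :
  codom x = x ord0 :: codom [ffun j : 'I_k => x (lift ord0 j)].
Proof.
rewrite !codomE enum_ordSl /=; congr (_ :: _).
by rewrite -map_comp; apply: eq_map => j; rewrite /= ffunE.
Qed.

Lemma size_codom_ord (T : Type) k (x : {ffun 'I_k -> T}) : size (codom x) = k.
Proof. by rewrite size_codom card_ord. Qed.

(** The recursion of [inner_faces] splits off the merge at position 0. Every later merge, and the
    last face, leaves the first entry alone, so the induction applies to the tail. *)
Lemma inner_faces_codom k U (x : {ffun 'I_k.+1 -> L}) :
  inner_faces U (codom x) =
  - (\sum_(i < k) U (codom (bar_merge i x)) *~ (-1) ^+ i.+1
     + U (codom [ffun j : 'I_k => x (widen_ord (leqnSn k) j)]) *~ (-1) ^+ k.+1).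
Proof.
elim: k U x => [|k IH] U x.
  rewrite big_ord0 add0r expr1 mulrN1z opprK codom_ffunS.
  set c := codom _; have /size0nil -> : size c = 0%N by rewrite size_codom_ord.
  by set d := codom _; have /size0nil -> : size d = 0%N by rewrite size_codom_ord.
pose y : {ffun 'I_k.+1 -> L} := [ffun j => x (lift ord0 j)].
pose y' : {ffun 'I_k -> L} := [ffun j => y (lift ord0 j)].
have cx : codom x = x ord0 :: codom y by exact: codom_ffunS.
have cy : codom y = y ord0 :: codom y' by exact: codom_ffunS.
have -> : inner_faces U (codom x) = U ((x ord0 * y ord0)%g :: codom y') -
    inner_faces (fun l => U (x ord0 :: l)) (codom y).
  by rewrite cx cy inner_faces_cons.
have -> : (x ord0 * y ord0)%g :: codom y' = codom (bar_merge ord0 x).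
  rewrite codom_ffunS; congr cons; last first.
    by apply: eq_codom => j; rewrite !ffunE.
  by rewrite !ffunE /=; congr (x _ * _)%g; apply: val_inj.
rewrite IH opprK big_ord_recl expr1 mulrN1z -[in RHS]addrA [in RHS]opprD opprK.
congr (_ + _); rewrite opprD; congr (_ + _).
  rewrite -sumrN; apply: eq_bigr => i _.
  rewrite [(-1) ^+ (lift ord0 i).+1]exprS mulN1r mulrNz opprK; congr (U _ *~ _).
  rewrite [in RHS]codom_ffunS; congr cons.
    by rewrite ffunE /=; congr (x _); apply: val_inj.
  apply: eq_codom => j; rewrite !ffunE /= /bump /= !add1n ltnS.
  rewrite (inj_eq (lift_inj (h := ord0))).
  have -> : lift ord0 (widen_ord (leqnSn k) j) = widen_ord (leqnSn k.+1) (lift ord0 j).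
    exact: val_inj.
  by [].
rewrite [in RHS]exprS mulN1r mulrNz opprK; congr (U _ *~ _).
rewrite [in RHS]codom_ffunS; congr cons.
  by rewrite ffunE; congr (x _); apply: val_inj.
by apply: eq_codom => j; rewrite !ffunE; congr (x _); apply: val_inj.
Qed.

Lemma coboundary_to_cochain k U :
  coboundary (to_cochain k U) = to_cochain k.+1 (scob U).
Proof.
apply/ffunP => x; rewrite !ffunE /scob inner_faces_codom opprK addrA.
congr (U _ + _ + U _ *~ _).
  by rewrite [in RHS]codom_ffunS.
by apply: eq_bigr => i _; rewrite ffunE.
Qed.

Definition of_cochain k (c : cochain TL k) : seq L -> F :=
  fun s => c [ffun i : 'I_k => nth 1%g s i].

Lemma codom_nth k (s : seq L) : size s = k -> codom [ffun i : 'I_k => nth 1%g s i] = s.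
Proof.
move=> szs; apply: (@eq_from_nth _ (1%g : L)); rewrite size_codom_ord // => i lti.
rewrite codomE (nth_map (Ordinal lti)) ?size_enum_ord // ffunE.
by rewrite nth_enum_ord.
Qed.

Lemma of_cochainK k c : to_cochain k (of_cochain c) = c.
Proof.
apply/ffunP => x; rewrite ffunE /of_cochain; congr (fun_of_fin c _).
apply/ffunP => i; rewrite ffunE codomE (nth_map i) ?size_enum_ord //.
by congr (x _); apply: val_inj; rewrite nth_ord_enum.
Qed.

Lemma to_cochainK k U s : size s = k -> of_cochain (to_cochain k U) s = U s.
Proof. by move=> szs; rewrite /of_cochain ffunE codom_nth. Qed.

Lemma scocycle_of_cochain k (z : cocycle TL k) : scocycle k (of_cochain (val z)).
Proof.
move=> s szs; rewrite -(to_cochainK _ szs) -coboundary_to_cochain of_cochainK.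
by rewrite (eqP (valP z)) /of_cochain ffunE.
Qed.

(** The default cocycle 0 makes the class total in [U]; it is meaningful only when [U] is a
    cocycle. *)
Definition bar_class k U : cohomology TL k :=
  \pi_(cohomology TL k) (insubd (0 : cocycle TL k) (to_cochain k U)).

Lemma val_insubd_cocycle k U : scocycle k U ->
  val (insubd (0 : cocycle TL k) (to_cochain k U)) = to_cochain k U.
Proof.
move=> cU; rewrite val_insubd ifT //; apply/eqP.
rewrite coboundary_to_cochain; apply/ffunP => x.
by rewrite !ffunE cU // size_codom_ord.
Qed.

Lemma bar_class_eq k U V : (0 < k)%N -> scocycle k U -> scocycle k V ->
  cohomologous k U V -> bar_class k U = bar_class k V.
Proof.
case: k => [//|k] _ cU cV [W UV]; apply/eqP; rewrite -Quotient.idealrBE; apply/asboolP.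
exists (to_cochain k W); rewrite raddfB /= !val_insubd_cocycle //.
by rewrite coboundary_to_cochain; apply/ffunP => x; rewrite !ffunE UV // size_codom_ord.
Qed.

Lemma eq_bar_class k U V : (forall s, size s = k -> U s = V s) ->
  bar_class k U = bar_class k V.
Proof.
move=> eqUV; rewrite /bar_class; have -> // : to_cochain k U = to_cochain k V.
by apply/ffunP => x; rewrite !ffunE eqUV // size_codom_ord.
Qed.

Lemma scocycleD k U V : scocycle k U -> scocycle k V ->
  scocycle k (fun l => U l + V l).
Proof. by move=> cU cV s szs; rewrite scobD cU // cV // addr0. Qed.

Lemma bar_classD k U V : scocycle k U -> scocycle k V ->
  bar_class k (fun l => U l + V l) = bar_class k U + bar_class k V.
Proof.
move=> cU cV; rewrite /bar_class -raddfD; congr (\pi _); apply: val_inj.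
rewrite [RHS]raddfD /= !val_insubd_cocycle //; last exact: scocycleD.
by apply/ffunP => x; rewrite !ffunE.
Qed.

Section Functional.
Variables (k : nat) (lam : (seq L -> F) -> F).
Hypothesis eq_lam :
  forall U V, (forall s, size s = k.+1 -> U s = V s) -> lam U = lam V.
Hypothesis lamB : forall U V, lam (fun s => U s - V s) = lam U - lam V.
Hypothesis lam_scob : forall U, lam (scob U) = 0.

(** Independent of the representative, since [lam] kills coboundaries. *)
Definition class_eval (x : cohomology TL k.+1) : F := lam (of_cochain (val (repr x))).

Lemma class_eval_pi z : class_eval (\pi_(cohomology TL k.+1) z) = lam (of_cochain (val z)).
Proof.
apply/eqP; rewrite -subr_eq0 -lamB.
have /asboolP [b bE] : repr (\pi_(cohomology TL k.+1) z) - z \in coboundaries TL k.+1.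
  by rewrite Quotient.idealrBE reprK.
rewrite -(lam_scob (of_cochain b)); apply/eqP/eq_lam => s szs.
rewrite -(to_cochainK (scob _) szs) -coboundary_to_cochain of_cochainK -bE.
by rewrite raddfB /of_cochain !ffunE.
Qed.

Lemma class_evalB x y : class_eval (x - y) = class_eval x - class_eval y.
Proof.
rewrite -[x]reprK -[y]reprK -raddfB !class_eval_pi -lamB; apply: eq_lam => s _.
by rewrite raddfB /of_cochain !ffunE.
Qed.

Lemma class_eval0 : class_eval 0 = 0.
Proof. by rewrite -(subrr 0) class_evalB subrr. Qed.

Lemma class_evalD : {morph class_eval : x y / x + y}.
Proof.
move=> x y; rewrite -[y in LHS]opprK class_evalB -[- y]sub0r class_evalB.
by rewrite class_eval0 sub0r opprK.
Qed.

Lemma class_eval_bar U : scocycle k.+1 U -> class_eval (bar_class k.+1 U) = lam U.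
Proof.
move=> cU; rewrite class_eval_pi val_insubd_cocycle //; apply: eq_lam => s szs.
exact: to_cochainK.
Qed.

(** One cocycle [U] computes both values, so invariance of a class functional reduces to a statement
    about [lam] on cocycles. *)
Lemma class_eval_pull (f : {multiplicative L -> L}) x :
  exists2 U, scocycle k.+1 U & class_eval x = lam U /\
    class_eval (cohomology_pull f x) = lam (U \o map f).
Proof.
exists (of_cochain (val (repr x))); first exact: scocycle_of_cochain.
split=> //; rewrite /cohomology_pull class_eval_pi; apply: eq_lam => s szs.
rewrite /of_cochain /= ffunE; congr (fun_of_fin _ _); apply/ffunP => i.
by rewrite !ffunE (nth_map 1%g) // szs.
Qed.

End Functional.

Lemma scocycle_map (f : {multiplicative L -> L}) k U : scocycle k U ->
  scocycle k (U \o map f).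
Proof.
move=> cU s szs; rewrite -[RHS](cU (map f s)) ?size_map // /scob /=.
rewrite -behead_map; congr (_ - _); clear.
elim: s U => [|a [|b s] IH] U //; rewrite [map f _]/= !inner_faces_cons -gmulfM.
by congr (_ - _); apply: IH.
Qed.

Lemma bar_class_pull (f : {multiplicative L -> L}) k U : scocycle k U ->
  cohomology_pull f (bar_class k U) = bar_class k (U \o map f).
Proof.
move=> cU; rewrite cohomology_pull_pi; congr (\pi _); apply: val_inj.
have cUf := scocycle_map f cU.
rewrite !val_insubd_cocycle //= val_insubd_cocycle //; apply/ffunP => x.
rewrite !ffunE /=; congr (U _); rewrite !codomE -map_comp.
by apply: eq_map => i; rewrite /= ffunE.
Qed.

End BarClasses.

(** * Evaluation on a free resolution *)

Section ChainEval.
Variables (L : finGroupType) (F : comNzRingType) (B : Type).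
(** Boundaries are given by their duals: [bd b h] stands for the sum of [c * h w b'] over the terms
    c w b' of the boundary of [b]. Then [bd_bd] says that boundaries square to zero, and [bd_const]
    that the augmentation kills boundaries of degree-one cells. *)
Variables (deg : B -> nat) (bd : B -> (L -> B -> F) -> F).
Hypothesis eq_bd : forall b h h',
  (forall w b', deg b = (deg b').+1 -> h w b' = h' w b') -> bd b h = bd b h'.
Hypothesis bdB : forall b h h',
  bd b (fun w b' => h w b' - h' w b') = bd b h - bd b h'.
Hypothesis bd_bd : forall b h,
  bd b (fun w b1 => bd b1 (fun w' b2 => h (w * w')%g b2)) = 0.
Hypothesis bd_const : forall b c, deg b = 1%N -> bd b (fun _ _ => c) = 0.
Implicit Types (U V : seq L -> F).

(* The dual of the comparison map phi from the free complex with basis [B] to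
   the bar resolution, built from the contracting homotopy:
   phi (b) = sum c [w | phi (b')] when the boundary of b is sum c w b'. *)
Fixpoint chain_eval k b U : F :=
  if k is k'.+1 then bd b (fun w b' => chain_eval k' b' (fun s => U (w :: s)))
  else U [::].

Lemma eq_chain_eval k b U V : (forall s, size s = k -> U s = V s) ->
  chain_eval k b U = chain_eval k b V.
Proof.
elim: k b U V => [|k IH] b U V eqUV /=; first exact: eqUV.
by apply: eq_bd => w b' _; apply: IH => s szs; apply: eqUV; rewrite /= szs.
Qed.

Lemma chain_evalB k b U V :
  chain_eval k b (fun s => U s - V s) = chain_eval k b U - chain_eval k b V.
Proof.
elim: k b U V => [|k IH] b U V //=; rewrite -bdB.
by apply: eq_bd => w b' _; rewrite IH.
Qed.

(** Merging [g] with the first entry absorbs it into the coefficients of the boundary; the deeper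
    faces assemble into a double boundary and vanish. *)
Lemma chain_eval_inner_faces k b U g : deg b = k.+1 ->
  chain_eval k.+1 b (fun s => inner_faces U (g :: s)) =
  bd b (fun w b' => chain_eval k b' (fun s => U ((g * w)%g :: s))).
Proof.
elim: k b U g => [|k IH] b U g degb /=.
  by rewrite bdB bd_const // subr0.
transitivity (bd b (fun w b' => chain_eval k.+1 b' (fun s => U ((g * w)%g :: s))
   - bd b' (fun w' b'' => chain_eval k b'' (fun s => U [:: g, (w * w')%g & s])))).
  apply: eq_bd => w b' degb'; have degb1 : deg b' = k.+1.
    by move: degb; rewrite degb' => -[].
  by rewrite -(IH b' (fun s => U (g :: s)) w degb1) -chain_evalB.
rewrite bdB (bd_bd b (fun v b'' => chain_eval k b'' (fun s => U [:: g, v & s]))).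
by rewrite subr0.
Qed.

(** Dual form of the fact that the comparison map commutes with boundaries. With trivial
    coefficients the group elements in the boundary of [b] disappear. *)
Lemma chain_eval_scob k b U : deg b = k.+1 ->
  chain_eval k.+1 b (scob U) = bd b (fun=> chain_eval k ^~ U).
Proof.
move=> degb; rewrite /= /scob.
case: k degb => [|k] degb; first by rewrite /= !bd_const.
transitivity (bd b (fun w b' => chain_eval k.+1 b' U
   - bd b' (fun w' b'' => chain_eval k b'' (fun s => U ((w * w')%g :: s))))).
  apply: eq_bd => w b' degb'; have degb1 : deg b' = k.+1.
    by move: degb; rewrite degb' => -[].
  by rewrite -(chain_eval_inner_faces U w degb1) -chain_evalB.
rewrite bdB (bd_bd b (fun v b'' => chain_eval k b'' (fun s => U (v :: s)))).
by rewrite subr0.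
Qed.

End ChainEval.

Lemma sum_alternating (V : zmodType) n (a : 'I_n -> 'I_n -> V) :
  (forall i, a i i = 0) -> (forall i j, i != j -> a i j = - a j i) ->
  \sum_i \sum_j a i j = 0.
Proof.
move=> a_diag a_anti; rewrite pair_bigA /=.
rewrite (bigID (fun ij : 'I_n * 'I_n => ij.1 < ij.2)%N) /=.
rewrite [X in _ + X](bigID (fun ij : 'I_n * 'I_n => ij.1 == ij.2)) /=.
rewrite [X in _ + (X + _)]big1 => [|[i j] /= /andP[_ /eqP ->] //]; rewrite add0r.
rewrite [X in _ + X](reindex_inj (h := fun ij : 'I_n * 'I_n => (ij.2, ij.1))) /=.
  rewrite [X in _ + X](eq_bigl (fun ij : 'I_n * 'I_n => ij.1 < ij.2)%N) => [|[i j]] /=.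
    rewrite -big_split /= big1 // => -[i j] /= ltij.
    by rewrite a_anti ?addNr // neq_ltn ltij.
  by rewrite -leqNgt eq_sym -val_eqE /= [RHS]ltn_neqAle andbC.
by move=> [i j] [i' j'] [-> ->].
Qed.

(** * Tensor products of one-generator complexes with a truncated bar resolution *)

Section PeriodicComplex.
Variables (L : finGroupType) (F : comNzRingType) (n : nat).
Hypothesis mulLC : forall x y : L, (x * y = y * x)%g.
(** [T i k] lists the terms of the differential leaving degree [k] in the i-th complex, which has
    one generator per degree; a multidegree [K] then names a generator of the tensor product. *)
Variable T : 'I_n -> nat -> seq (F * L).
Hypothesis T0 : forall i, T i 0 = [::].
Hypothesis T_T : forall i k (phi : L -> F),
  \sum_(x <- T i k.+1) x.1 * \sum_(y <- T i k) y.1 * phi (x.2 * y.2)%g = 0.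
Hypothesis T_aug : forall i k, \sum_(x <- T i k) x.1 = 0.

Implicit Types (K : {ffun 'I_n -> nat}) (i j : 'I_n).

Definition decr i K : {ffun 'I_n -> nat} := [ffun j => K j - (j == i)]%N.

Definition ksign i K : F := (-1) ^+ (\sum_(j < n | (j < i)%N) K j).

Definition bdK K (h : L -> {ffun 'I_n -> nat} -> F) : F :=
  \sum_i ksign i K * \sum_(x <- T i (K i)) x.1 * h x.2 (decr i K).

Lemma decrC i j K : decr i (decr j K) = decr j (decr i K).
Proof. by apply/ffunP => l; rewrite !ffunE subnAC. Qed.

Lemma ksign_decr i j K : (0 < K i)%N ->
  ksign j (decr i K) = if (i < j)%N then - ksign j K else ksign j K.
Proof.
move=> Ki; rewrite /ksign; case: ifPn => ij.
  rewrite (bigD1 i) //= [in RHS](bigD1 i) //= ffunE eqxx.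
  rewrite (eq_bigr K) => [|l /andP[_ /negPf li]]; last by rewrite ffunE li subn0.
  by rewrite -[in RHS](subnK Ki) addn1 addSn exprS mulN1r opprK.
congr (_ ^+ _); apply: eq_bigr => l lj; rewrite ffunE.
by case: eqP ij => [<-|]; rewrite ?lj ?subn0.
Qed.

(** For distinct i and j the two orders of differentiating carry opposite Koszul signs, and
    commutativity of [L] matches their terms. The diagonal terms vanish by [T_T]. *)
Lemma bdK_bdK K h :
  bdK K (fun w K1 => bdK K1 (fun w' K2 => h (w * w')%g K2)) = 0.
Proof.
pose a i j := ksign i K * ksign j (decr i K) *
  \sum_(x <- T i (K i)) x.1 * \sum_(y <- T j (decr i K j)) y.1 *
    h (x.2 * y.2)%g (decr j (decr i K)).
transitivity (\sum_i \sum_j a i j).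
  apply: eq_bigr => i _; rewrite /bdK mulr_sumr.
  under eq_bigr do rewrite mulr_sumr mulr_sumr.
  rewrite exchange_big; apply: eq_bigr => j _; rewrite /a mulr_sumr.
  by apply: eq_bigr => x _; ring.
have a0 i j : K i = 0%N -> a i j = 0.
  by move=> Ki; rewrite /a Ki T0 big_nil mulr0.
have a0' i j : i != j -> K j = 0%N -> a i j = 0.
  move=> ij Kj; rewrite /a ffunE Kj sub0n T0; rewrite [X in _ * X]big1 ?mulr0 // => x _.
  by rewrite big_nil mulr0.
apply: sum_alternating => [i|i j ij].
  case Ki: (K i) => [|k]; first exact: a0.
  rewrite /a ffunE eqxx Ki subn1 /=.
  by rewrite (T_T i k (fun w => h w (decr i (decr i K)))) mulr0.
have [Ki|Ki] := posnP (K i); first by rewrite a0 // a0' 1?eq_sym // oppr0.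
have [Kj|Kj] := posnP (K j); first by rewrite a0' // a0 // oppr0.
have -> : a j i = ksign j K * ksign i (decr j K) *
  \sum_(x <- T i (K i)) x.1 * \sum_(y <- T j (K j)) y.1 *
    h (x.2 * y.2)%g (decr j (decr i K)).
  rewrite /a ffunE (negPf ij) subn0; congr (_ * _).
  under eq_bigr do rewrite mulr_sumr.
  rewrite exchange_big; apply: eq_bigr => x _; rewrite mulr_sumr.
  by apply: eq_bigr => y _; rewrite mulLC decrC mulrCA.
rewrite /a ffunE eq_sym (negPf ij) subn0 !ksign_decr //.
by move: ij; rewrite neq_ltn => /orP[] ij; rewrite ij ltnNge ltnW //=; ring.
Qed.

Lemma bdKB K h h' : bdK K (fun w K' => h w K' - h' w K') = bdK K h - bdK K h'.
Proof.
rewrite /bdK -sumrB; apply: eq_bigr => i _; rewrite -mulrBr -sumrB; congr (_ * _).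
by apply: eq_bigr => x _; rewrite mulrBr.
Qed.

Lemma bdK_const K (c : {ffun 'I_n -> nat} -> F) : bdK K (fun=> c) = 0.
Proof. by apply: big1 => i _; rewrite -mulr_suml T_aug mul0r mulr0. Qed.

Lemma sum_decr i K : (0 < K i)%N -> (\sum_j K j = (\sum_j decr i K j).+1)%N.
Proof.
move=> Ki; rewrite (bigD1 i) //= [in RHS](bigD1 i) //= ffunE eqxx.
rewrite [in RHS](eq_bigr K) => [|j /negPf ji]; last by rewrite ffunE ji subn0.
by rewrite -addSn subn1 prednK.
Qed.

(* Basis of a truncated free resolution recording additivity in its degree-one
   generators: [SlantHom s t] bounds a_s + s a_t - a_(s t). *)
Inductive slant := Slant0 | Slant1 of L | SlantHom of L & L.

Definition slant_deg z := match z with Slant0 => 0%N | Slant1 _ => 1%N | SlantHom _ _ => 2%N end.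

(** The differential of the bar resolution of [L] in degrees at most two. *)
Definition bdZ z (h : L -> slant -> F) : F :=
  match z with
  | Slant0 => 0
  | Slant1 t => h t Slant0 - h 1%g Slant0
  | SlantHom s t => h 1%g (Slant1 s) + h s (Slant1 t) - h 1%g (Slant1 (s * t)%g)
  end.

Definition cell := (slant * {ffun 'I_n -> nat})%type.
Definition cell_deg (b : cell) := (slant_deg b.1 + \sum_i b.2 i)%N.
(** The tensor product is formed over the commutative group ring of [L]; mapping it to the bar
    resolution produces shuffle products. *)
Definition bd (b : cell) (h : L -> cell -> F) : F :=
  bdZ b.1 (fun w z => h w (z, b.2)) +
  (-1) ^+ slant_deg b.1 * bdK b.2 (fun w K => h w (b.1, K)).

Lemma eq_bd b h h' :
  (forall w b', cell_deg b = (cell_deg b').+1 -> h w b' = h' w b') -> bd b h = bd b h'.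
Proof.
case: b => z K eqh; congr (_ + _ * _).
  by case: z eqh => [//|t|s t] eqh /=; rewrite !eqh.
apply: eq_bigr => i _; have [Ki|Ki] := posnP (K i); first by rewrite /= Ki T0 !big_nil.
by congr (_ * _); apply: eq_bigr => x _; rewrite eqh // /cell_deg /= (sum_decr Ki) addnS.
Qed.

Lemma bdB b h h' : bd b (fun w b' => h w b' - h' w b') = bd b h - bd b h'.
Proof.
rewrite /bd bdKB; case: b => -[|t|s t] K /=; ring.
Qed.

Lemma bdZ_bdK z K (h : L -> cell -> F) :
  bdZ z (fun w z' => bdK K (fun w' K' => h (w * w')%g (z', K'))) =
  bdK K (fun w K' => bdZ z (fun w' z' => h (w * w')%g (z', K'))).
Proof.
have bdKD h1 h2 : bdK K (fun w K' => h1 w K' + h2 w K') = bdK K h1 + bdK K h2.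
  rewrite /bdK -big_split; apply: eq_bigr => i _ /=; rewrite -mulrDr -big_split.
  by congr (_ * _); apply: eq_bigr => x _; rewrite mulrDr.
have E w z' : bdK K (fun w' K' => h (w * w')%g (z', K')) =
  bdK K (fun w' K' => h (w' * w)%g (z', K')).
  by apply: eq_bigr => i _; congr (_ * _); apply: eq_bigr => x _; rewrite mulLC.
case: z => [|t|s t] /=; rewrite ?bdKB ?bdKD ?E //.
by rewrite bdK_const.
Qed.

Lemma bdZ_bdZ z K (h : L -> cell -> F) :
  bdZ z (fun w z1 => bdZ z1 (fun w' z2 => h (w * w')%g (z2, K))) = 0.
Proof. by case: z => [|t|s t] //=; rewrite ?mulg1 ?mul1g; ring. Qed.

Lemma bd_bd b h :
  bd b (fun w b1 => bd b1 (fun w' b2 => h (w * w')%g b2)) = 0.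
Proof.
case: b => z K; rewrite /bd /=.
have -> : bdZ z (fun w z1 => bdZ z1 (fun w' z2 => h (w * w')%g (z2, K)) +
     (-1) ^+ slant_deg z1 * bdK K (fun w' K' => h (w * w')%g (z1, K'))) =
  - (-1) ^+ slant_deg z * bdK K (fun w K' => bdZ z (fun w' z' => h (w * w')%g (z', K'))).
  rewrite -bdZ_bdK -[RHS]add0r -[X in _ = X + _](bdZ_bdZ z K h).
  by case: z => [|t|s t] /=; rewrite ?mulr0 ?expr0 ?expr1; ring.
have -> : bdK K (fun w K1 => bdZ z (fun w' z' => h (w * w')%g (z', K1)) +
    (-1) ^+ slant_deg z * bdK K1 (fun w' K2 => h (w * w')%g (z, K2))) =
  bdK K (fun w K1 => bdZ z (fun w' z' => h (w * w')%g (z', K1))) +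
  (-1) ^+ slant_deg z * bdK K (fun w K1 => bdK K1 (fun w' K2 => h (w * w')%g (z, K2))).
  rewrite /bdK mulr_sumr -big_split; apply: eq_bigr => i _ /=.
  rewrite [(-1) ^+ _ * (_ * _)]mulrCA -mulrDr; congr (_ * _).
  by rewrite mulr_sumr -big_split; apply: eq_bigr => x _ /=; ring.
by rewrite (bdK_bdK K (fun v K2 => h v (z, K2))) mulr0 addr0; ring.
Qed.

Lemma bd_const b c : cell_deg b = 1%N -> bd b (fun _ _ => c) = 0.
Proof.
case: b => z K; rewrite /bd /cell_deg /= bdK_const mulr0 addr0.
by case: z => [|t|s t] //=; rewrite subrr.
Qed.

Definition cell_eval := chain_eval bd.

Lemma eq_cell_eval k b U V : (forall s, size s = k -> U s = V s) ->
  cell_eval k b U = cell_eval k b V.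
Proof. exact: (eq_chain_eval eq_bd). Qed.

Lemma cell_evalB k b U V :
  cell_eval k b (fun s => U s - V s) = cell_eval k b U - cell_eval k b V.
Proof. exact: (chain_evalB eq_bd bdB). Qed.

Lemma cell_evalZ k b c U :
  cell_eval k b (fun s => c * U s) = c * cell_eval k b U.
Proof.
have bd_scale b' h : bd b' (fun w b1 => c * h w b1) = c * bd b' h.
  rewrite /bd mulrDr; congr (_ + _); first by case: b'.1 => [|t|s t] /=; ring.
  rewrite mulrCA; congr (_ * _); rewrite /bdK mulr_sumr; apply: eq_bigr => i _.
  rewrite mulrCA [in RHS]mulr_sumr; congr (_ * _).
  by apply: eq_bigr => x _; rewrite mulrCA.
elim: k b U => [|k IH] b U //=; rewrite -bd_scale.
by apply: eq_bd => w b' _; apply: IH.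
Qed.

(** By [bdK_const] the directions of [K] contribute nothing to a boundary with trivial
    coefficients. *)
Lemma cell_eval_scob k b U : cell_deg b = k.+1 -> cell_eval k.+1 b (scob U) =
  bdZ b.1 (fun=> (fun z => cell_eval k (z, b.2) U)).
Proof.
move=> degb; rewrite /cell_eval (chain_eval_scob eq_bd bdB bd_bd bd_const) //.
by rewrite /bd bdK_const mulr0 addr0.
Qed.

Lemma cell_eval_scob_slant1 k t K U : cell_deg (Slant1 t, K) = k.+1 ->
  cell_eval k.+1 (Slant1 t, K) (scob U) = 0.
Proof. by move=> degb; rewrite cell_eval_scob //= subrr. Qed.

(** With trivial coefficients the cell [(SlantHom s t, K)] bounds the difference of the two sides,
    and [scob U] vanishes on it. *)
Lemma cell_eval_slant1M k s t K U : scocycle k U -> cell_deg (Slant1 s, K) = k ->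
  cell_eval k (Slant1 (s * t)%g, K) U =
  cell_eval k (Slant1 s, K) U + cell_eval k (Slant1 t, K) U.
Proof.
move=> cU degb.
have degb2 : cell_deg (SlantHom s t, K) = k.+1 by rewrite -degb.
have E0 : cell_eval k.+1 (SlantHom s t, K) (scob U) = 0.
  have := cell_evalB k.+1 (SlantHom s t, K) (scob U) (scob U).
  rewrite subrr => <-; by apply: eq_cell_eval => l szl; rewrite subrr cU.
apply/eqP; rewrite eq_sym -subr_eq0; apply/eqP; rewrite -[RHS]E0.
exact: esym (cell_eval_scob U degb2).
Qed.

(** Every bar entry occurring in the image of such a cell is a coefficient from [T], hence fixed by
    [g]. *)
Lemma cell_eval_slant0_map (g : L -> L) k K U :
  (forall i l x, x \in T i l -> g x.2 = x.2) ->
  cell_eval k (Slant0, K) (U \o map g) = cell_eval k (Slant0, K) U.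
Proof.
move=> fix_g; elim: k K U => [|k IH] K U //=; rewrite /bd /= !add0r; congr (_ * _).
apply: eq_bigr => i _; congr (_ * _); rewrite big_seq [RHS]big_seq.
apply: eq_bigr => x xT; congr (_ * _); rewrite -(IH _ (fun s => U (x.2 :: s))).
by apply: eq_cell_eval => s _; rewrite /= (fix_g _ _ _ xT).
Qed.

Lemma cell_eval_slant1_map (g : L -> L) k t K U :
  g 1%g = 1%g -> (forall i l x, x \in T i l -> g x.2 = x.2) ->
  cell_eval k (Slant1 t, K) (U \o map g) = cell_eval k (Slant1 (g t), K) U.
Proof.
move=> g1 fix_g; elim: k K U => [|k IH] K U //=; rewrite /bd /=; congr (_ + _ * _).
  congr (_ - _).
    rewrite -(cell_eval_slant0_map _ _ (fun s => U (g t :: s)) fix_g).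
    by apply: eq_cell_eval.
  rewrite -(cell_eval_slant0_map _ _ (fun s => U (1%g :: s)) fix_g).
  by apply: eq_cell_eval => s _; rewrite /= g1.
apply: eq_bigr => i _; congr (_ * _); rewrite big_seq [RHS]big_seq.
apply: eq_bigr => x xT; congr (_ * _); rewrite -(IH _ (fun s => U (x.2 :: s))).
by apply: eq_cell_eval => s _; rewrite /= (fix_g _ _ _ xT).
Qed.

End PeriodicComplex.

(** * Coefficients of products of linear forms read off by evaluation on cells *)

Section MonomialEvaluation.
Variables (L : finGroupType) (F : comNzRingType) (n : nat).
Variable T : 'I_n -> nat -> seq (F * L).
Hypothesis T0 : forall i, T i 0 = [::].
Variables (J : eqType) (Y : J -> seq L -> F) (mu : J -> 'I_n -> F).
Hypothesis Y_diff : forall m i j k l x y, i != j -> x \in T i k -> y \in T j l ->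
  Y m [:: x.2; y.2] = 0.
Hypothesis Y_same : forall m i k, ~~ odd k ->
  \sum_(x <- T i k.+2) x.1 * \sum_(y <- T i k.+1) y.1 * Y m [:: x.2; y.2] = mu m i.
Implicit Types (K : {ffun 'I_n -> nat}) (i j : 'I_n) (ms : seq J).

Definition doublef K : {ffun 'I_n -> nat} := [ffun i => (K i).*2].

Lemma ksign_doublef K i : ksign F i (doublef K) = 1.
Proof.
rewrite /ksign -signr_odd.
have -> : \sum_(j < n | (j < i)%N) doublef K j = (\sum_(j < n | (j < i)%N) K j).*2.
  rewrite -mul2n big_distrr; apply: eq_bigr => j _.
  by rewrite ffunE -mul2n.
by rewrite odd_double.
Qed.

Lemma cell_eval_cup2 k m K V :
  cell_eval T k.+2 (Slant0 L, doublef K) (cup 2 (Y m) V) =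
  \sum_(i | (0 < K i)%N) mu m i * cell_eval T k (Slant0 L, doublef (decr i K)) V.
Proof.
rewrite [RHS]big_mkcond /= /bd /= add0r mul1r; apply: eq_bigr => i _.
rewrite ksign_doublef mul1r ffunE; case: posnP => [->|Ki].
  by rewrite double0 T0 big_nil.
have Ki2 : (0 < doublef K i)%N by rewrite ffunE double_gt0.
pose E := cell_eval T k (Slant0 L, doublef (decr i K)) V.
transitivity (\sum_(x <- T i (K i).*2) x.1 *
   \sum_(y <- T i (K i).*2.-1) y.1 * (Y m [:: x.2; y.2] * E)).
  rewrite big_seq [RHS]big_seq; apply: eq_bigr => x xT; congr (_ * _).
  (* By [Y_diff] the second boundary must be taken along the same axis [i] as the first. *)
  rewrite add0r mul1r /bdK (bigD1 i) //= [X in _ + X]big1 ?addr0 => [|j ji].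
    rewrite ksign_decr // ltnn ksign_doublef mul1r !ffunE eqxx subn1.
    apply: eq_bigr => y _; congr (_ * _).
    have -> : decr i (decr i (doublef K)) = doublef (decr i K).
      by apply/ffunP => j; rewrite !ffunE; case: eqP => //= _; lia.
    exact: (cell_evalZ T0).
  rewrite big_seq big1 ?mulr0 // => y yT.
  rewrite (cell_evalZ T0) (Y_diff _ _ xT yT) ?mul0r ?mulr0 //.
  by rewrite eq_sym.
rewrite -/E -(@Y_same m i (K i).-1.*2) ?odd_double //.
have -> : (K i).*2 = (K i).-1.*2.+2 by rewrite -doubleS prednK.
rewrite mulr_suml; apply: eq_bigr => x _; rewrite -mulrA mulr_suml; congr (_ * _).
by apply: eq_bigr => y _; rewrite mulrA.
Qed.

(** Since [x] vanishes at 1 and on the coefficients of [T], only the term [t] of the slant boundary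
    t - 1 survives. *)
Lemma cell_eval_cup1 k t K x V : x [:: 1%g] = 0 ->
  (forall i l w, w \in T i l -> x [:: w.2] = 0) ->
  cell_eval T k.+1 (Slant1 t, K) (cup 1 x V) =
  x [:: t] * cell_eval T k (Slant0 L, K) V.
Proof.
move=> x1 xT; rewrite /= /bd /= (cell_evalZ T0) (cell_evalZ T0) x1 mul0r subr0.
rewrite [bdK _ _ _]big1 ?mulr0 ?addr0 // => i _; rewrite big_seq big1 ?mulr0 // => w wT.
by rewrite (cell_evalZ T0) (xT _ _ _ wT) mul0r mulr0.
Qed.

Variable lead : J -> 'I_n.
Hypothesis mu_lead : forall m i, (i < lead m)%N -> mu m i = 0.

(** When the entries of [K] sum to [size ms], this is the coefficient of y^K in the product over
    [ms] of the linear forms sum_i [mu m i] y_i; [cup_coef_cons] expands the first factor. *)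
Definition cup_coef K ms := cell_eval T (size ms).*2 (Slant0 L, doublef K) (cups Y ms).

Lemma cup_coef_cons K m ms :
  cup_coef K (m :: ms) = \sum_(i | (0 < K i)%N) mu m i * cup_coef (decr i K) ms.
Proof. exact: cell_eval_cup2. Qed.

Definition weight K := (\sum_(i < n) i * K i)%N.

Lemma weight_decr i K : (0 < K i)%N -> weight K = (i + weight (decr i K))%N.
Proof.
move=> Ki; rewrite /weight (bigD1 i) //= [X in (_ = _ + X)%N](bigD1 i) //= ffunE eqxx.
rewrite addnA; congr (_ + _)%N; first by rewrite -mulnS subn1 prednK.
by apply: eq_bigr => j /negPf ji; rewrite ffunE ji subn0.
Qed.

(** A factor [m] involves only variables of index at least [lead m], so every monomial of the
    product has weight at least the sum of the leads. *)
Lemma cup_coef_low K ms : (weight K < \sum_(m <- ms) lead m)%N -> cup_coef K ms = 0.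
Proof.
elim: ms K => [|m ms IH] K; first by rewrite big_nil.
rewrite big_cons cup_coef_cons => ltw; apply: big1 => i Ki.
have [lti|lei] := ltnP i (lead m); first by rewrite mu_lead // mul0r.
rewrite IH ?mulr0 //; move: ltw; rewrite (weight_decr Ki); lia.
Qed.

Definition lead_count ms : {ffun 'I_n -> nat} := [ffun i => count (fun m => lead m == i) ms].

Lemma weight_lead_count ms : weight (lead_count ms) = (\sum_(m <- ms) lead m)%N.
Proof.
elim: ms => [|m ms IH].
  by rewrite big_nil; apply: big1 => i _; rewrite ffunE muln0.
have Km : (0 < lead_count (m :: ms) (lead m))%N by rewrite ffunE /= eqxx.
rewrite (weight_decr Km) big_cons -IH; congr (_ + weight _)%N.
by apply/ffunP => i; rewrite !ffunE /= eq_sym addKn.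
Qed.

(** Taking a variable beyond the leading one from some factor leaves too little weight for the
    remaining factors, so the leading monomial arises in one way only. *)
Lemma cup_coef_lead ms : cup_coef (lead_count ms) ms = \prod_(m <- ms) mu m (lead m).
Proof.
elim: ms => [|m ms IH]; first by rewrite big_nil.
have Km : (0 < lead_count (m :: ms) (lead m))%N by rewrite ffunE /= eqxx.
rewrite cup_coef_cons big_cons (bigD1 (lead m)) //=.
have dec : decr (lead m) (lead_count (m :: ms)) = lead_count ms.
  by apply/ffunP => i; rewrite !ffunE /= eq_sym addKn.
rewrite dec IH [X in _ + X]big1 ?addr0 // => i /andP[Ki il].
have [lti|lei] := ltnP i (lead m); first by rewrite mu_lead // mul0r.
rewrite cup_coef_low ?mulr0 // -weight_lead_count -dec.
have := weight_decr Ki; rewrite (weight_decr Km).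
by move: il; rewrite -val_eqE /=; lia.
Qed.

End MonomialEvaluation.

(** * Integral lifts and carries *)

Section IntegralLifts.
Variables (q : nat).
Hypothesis q_gt1 : (1 < q)%N.
Notation R := 'Z_q.

Definition zlift (a : R) : int := (a : nat)%:Z.
Definition mxlift m k (A : 'M[R]_(m, k)) : 'M[int]_(m, k) := map_mx zlift A.
Definition mxquo m k (A : 'M[int]_(m, k)) : 'M[int]_(m, k) :=
  map_mx (fun z => (z %/ q)%Z) A.

Lemma ltn_Zp (a : R) : (a < q)%N.
Proof. by have := ltn_ord a; rewrite [X in (_ < X)%N]Zp_cast. Qed.

Lemma zlift_intr z : zlift z%:~R = (z %% q)%Z.
Proof.
have q0 : q%:Z != 0 by case: q q_gt1.
rewrite {1}(divz_eq z q) intrD intrM [q%:Z%:~R](_ : _ = 0) ?mulr0 ?add0r; last first.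
  exact: pchar_Zp.
have := modz_ge0 z q0; have : (z %% q < q)%Z by rewrite ltz_pmod // ltz_nat ltnW.
case: (z %% q)%Z => // k; rewrite ltz_nat => ltk _.
by rewrite /zlift val_Zp_nat // modn_small.
Qed.

Lemma zlift_nat k : (k < q)%N -> zlift k%:R = k%:Z.
Proof. by move=> ltk; rewrite /zlift val_Zp_nat // modn_small. Qed.

Lemma zliftK (a : R) : (zlift a)%:~R = a.
Proof. exact: natr_Zp. Qed.

Lemma mxliftK m k (A : 'M[R]_(m, k)) : map_mx intr (mxlift A) = A.
Proof. by apply/matrixP => i j; rewrite !mxE zliftK. Qed.

Lemma mxlift_eq m k (Z : 'M[int]_(m, k)) A : map_mx intr Z = A ->
  Z = q%:Z *: mxquo Z + mxlift A.
Proof.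
move=> <-; apply/matrixP => i j; rewrite !mxE zlift_intr mulrC.
exact: divz_eq.
Qed.

Lemma mxlift_mul m k l (A : 'M[R]_(m, k)) (B : 'M[R]_(k, l)) :
  mxlift A *m mxlift B = q%:Z *: mxquo (mxlift A *m mxlift B) + mxlift (A *m B).
Proof. by apply: mxlift_eq; rewrite map_mxM !mxliftK. Qed.

Lemma mxlift_add m k (A B : 'M[R]_(m, k)) :
  mxlift A + mxlift B = q%:Z *: mxquo (mxlift A + mxlift B) + mxlift (A + B).
Proof. by apply: mxlift_eq; rewrite map_mxD !mxliftK. Qed.

Lemma mxscale_inj m k (A B : 'M[int]_(m, k)) : q%:Z *: A = q%:Z *: B -> A = B.
Proof.
have q0 : q%:Z != 0 by case: q q_gt1.
move=> /matrixP E; apply/matrixP => i j; have := E i j; rewrite !mxE.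
exact: mulfI.
Qed.

(** [carry] and [mcarry] measure the failure of the integral lift to be additive and multiplicative,
    divided by [q]. The first yields Bockstein cocycles on the vector group, the second the
    extension cocycle on the general linear group. *)
Definition carry m k (A B : 'M[R]_(m, k)) := mxquo (mxlift A + mxlift B).
Definition mcarry m k l (A : 'M[R]_(m, k)) (B : 'M[R]_(k, l)) :=
  mxquo (mxlift A *m mxlift B).

Lemma scale_carry m k (A B : 'M[R]_(m, k)) :
  q%:Z *: carry A B = mxlift A + mxlift B - mxlift (A + B).
Proof. by rewrite [in RHS]mxlift_add addrK. Qed.

Lemma scale_mcarry m k l (A : 'M[R]_(m, k)) (B : 'M[R]_(k, l)) :
  q%:Z *: mcarry A B = mxlift A *m mxlift B - mxlift (A *m B).
Proof. by rewrite [in RHS]mxlift_mul addrK. Qed.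

Lemma carryE m k (A B : 'M[R]_(m, k)) i j :
  carry A B i j = ((A i j + B i j)%N %/ q)%N%:Z.
Proof. by rewrite !mxE -PoszD -divz_nat. Qed.

Lemma carry_cocycle m k (A B C : 'M[R]_(m, k)) :
  carry A B + carry (A + B) C = carry B C + carry A (B + C).
Proof.
apply: mxscale_inj; rewrite !scalerDr !scale_carry [A + (B + C)]addrA.
move: (mxlift A) (mxlift B) (mxlift C) => a b c.
move: (mxlift (A + B)) (mxlift (B + C)) (mxlift _) => d e f.
by apply/matrixP => i j; rewrite !mxE; ring.
Qed.

Lemma mcarry_cocycle m (A B C : 'M[R]_m) :
  mcarry A B *m mxlift C + mcarry (A *m B) C =
  mxlift A *m mcarry B C + mcarry A (B *m C).
Proof.
apply: mxscale_inj; rewrite !scalerDr scalemxAl scalemxAr !scale_mcarry.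
rewrite mulmxBl mulmxBr !mulmxA.
by rewrite !addrA !subrK.
Qed.

(** Both sides come from lifting A(u + v). The cochain u |-> [mcarry A u] thereby makes the carry
    cocycle natural up to a coboundary, as [bockstein_map] requires. *)
Lemma mcarry_carry m (A : 'M[R]_m) (u v : 'cV[R]_m) :
  carry (A *m u) (A *m v) + mcarry A u + mcarry A v =
  mxlift A *m carry u v + mcarry A (u + v).
Proof.
apply: mxscale_inj; rewrite !scalerDr scalemxAr !scale_carry !scale_mcarry.
rewrite mulmxBr !mulmxDr.
move: (_ *m mxlift u) (_ *m mxlift v) (_ *m mxlift (u + v)) => a b c.
move: (mxlift (A *m u)) (mxlift (A *m v)) (mxlift _) => d e f.
by apply/matrixP => i j; rewrite !mxE; ring.
Qed.

End IntegralLifts.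

(** * The equivariant map to the cohomology of the vector group *)

HB.instance Definition _ (A : zmodType) (G H : finGroupType) (f : {multiplicative G -> H}) k :=
  GRing.isZmodMorphism.Build _ _ (@cohomology_pull A G H f k) (@cohomology_pullB A G H f k).

Section DicksonDifferential.
Variables (p n r : nat) (F : finFieldType).
Hypotheses (charF : p \in [pchar F]) (cardF : #|F| = p) (r_gt0 : (0 < r)%N).
Local Notation q := (p ^ r)%N.
Local Notation R := 'Z_q.
Local Notation L := (GL_vec R n).
Local Notation m := n.-1.+1.
Local Notation rd := (map_mx (intr : int -> F)).

Let q_gt1 : (1 < q)%N.
Proof. by rewrite -{1}(exp1n r) ltn_exp2r // prime_gt1 // (pcharf_prime charF). Qed.

Lemma natrF_p : p%:R = 0 :> F.
Proof. exact: pcharf0. Qed.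

Lemma natrF_q : q%:Z%:~R = 0 :> F.
Proof. by rewrite -pmulrn natrX natrF_p expr0n eqn0Ngt r_gt0. Qed.

Lemma rd_scale k l (A : 'M[int]_(k, l)) : rd (q%:Z *: A) = 0.
Proof. by rewrite map_mxZ /= natrF_q scale0r. Qed.

Let mxD00 (A B : 'M[F]_1) : (A + B) 0 0 = A 0 0 + B 0 0.
Proof. by rewrite mxE. Qed.

Definition mxred k l (A : 'M[R]_(k, l)) : 'M[F]_(k, l) := rd (mxlift A).

Lemma mxredD k l (A B : 'M[R]_(k, l)) : mxred (A + B) = mxred A + mxred B.
Proof.
by rewrite /mxred -map_mxD (mxlift_add q_gt1) map_mxD rd_scale add0r.
Qed.

Lemma mxredM k l h (A : 'M[R]_(k, l)) (B : 'M[R]_(l, h)) :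
  mxred (A *m B) = mxred A *m mxred B.
Proof.
by rewrite /mxred -map_mxM (mxlift_mul q_gt1) map_mxD rd_scale add0r.
Qed.

Definition linear_form (a : 'rV[F]_m) (s : seq L) : F :=
  if s is u :: _ then (a *m mxred (u : 'cV[R]_m)) 0 0 else 0.

(** The combination, with coefficients [a], of the classes of the extension of Z/p^r by Z/p with
    total group Z/p^(r+1), taken in each coordinate. *)
Definition bockstein (a : 'rV[F]_m) (s : seq L) : F :=
  if s is [:: u, v & _] then (a *m rd (carry (u : 'cV[R]_m) v)) 0 0 else 0.

Lemma scocycle_linear_form a : scocycle 1 (linear_form a).
Proof.
case=> [|u [|v [|? ?]]] //= _; rewrite /scob /=.
have -> : (u * v)%g = (u : 'cV[R]_m) + v :> 'cV[R]_m by [].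
by rewrite mxredD mulmxDr mxD00; ring.
Qed.

Lemma scocycle_bockstein a : scocycle 2 (bockstein a).
Proof.
case=> [|u [|v [|w [|? ?]]]] //= _; rewrite /scob /=.
have := congr1 (fun A => (a *m rd A) 0 0) (carry_cocycle q_gt1 (u : 'cV[R]_m) v w).
rewrite !map_mxD !mulmxDr !mxD00 => E.
have alg (x y z t : F) : x + y = z + t -> z - (y - (t - x)) = 0.
  by move=> xy; have -> : z = x + y - t; [rewrite xy|]; ring.
exact: alg E.
Qed.

Lemma linear_form_map a (g : {'GL_n[R]}) s :
  linear_form a (map (GL_mulv g) s) = linear_form (a *m mxred (GLval g)) s.
Proof. by case: s => [|u s] //=; rewrite -mulmxA -mxredM. Qed.

Lemma bockstein_map a (g : {'GL_n[R]}) :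
  cohomologous 2 (bockstein a \o map (GL_mulv g)) (bockstein (a *m mxred (GLval g))).
Proof.
exists (fun s => if s is u :: _ then - (a *m rd (mcarry (GLval g) (u : 'cV[R]_m))) 0 0 else 0).
case=> [|u [|v [|? ?]]] //= _; rewrite /scob /=.
have := congr1 (fun A => (a *m rd A) 0 0) (mcarry_carry q_gt1 (GLval g) u v).
rewrite !map_mxD map_mxM -/(mxred _) !mulmxDr mulmxA !mxD00 => E.
have alg (x y z t w : F) : x + y + z = t + w -> x - t = - z - (- w - - y).
  by move=> xyz; have -> : t = x + y + z - w; [rewrite xyz|]; ring.
exact: alg E.
Qed.

Definition nonzero_forms : seq 'rV[F]_m := rem 0 (enum {: 'rV[F]_m}).
Definition other_forms (a : 'rV[F]_m) := rem a nonzero_forms.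

Lemma mem_nonzero_forms a : (a \in nonzero_forms) = (a != 0).
Proof. by rewrite mem_rem_uniq ?enum_uniq // inE mem_enum andbT. Qed.

Lemma uniq_nonzero_forms : uniq nonzero_forms.
Proof. by rewrite rem_uniq ?enum_uniq. Qed.

Lemma size_nonzero_forms : size nonzero_forms = (p ^ m).-1.
Proof. by rewrite size_rem ?mem_enum // -cardE card_mx cardF // mul1n. Qed.

Lemma size_other_forms a : a != 0 -> size (other_forms a) = (p ^ m).-2.
Proof. by move=> a0; rewrite size_rem ?mem_nonzero_forms // size_nonzero_forms. Qed.

Lemma perm_other_forms a : a != 0 -> perm_eq nonzero_forms (a :: other_forms a).
Proof. by move=> a0; apply: perm_to_rem; rewrite mem_nonzero_forms. Qed.

Lemma perm_other_forms_mul a (A B : 'M[F]_m) : a != 0 -> A *m B = 1%:M ->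
  perm_eq (map (mulmx^~ A) (other_forms a)) (other_forms (a *m A)).
Proof.
move=> a0 AB; have injA : injective (mulmx^~ A : 'rV[F]_m -> 'rV[F]_m).
  by apply: (can_inj (g := mulmx^~ B)) => b; rewrite /= -mulmxA AB mulmx1.
have aA0 : a *m A != 0 by rewrite -(mul0mx _ A) (inj_eq injA).
rewrite -(perm_cons (a *m A)).
apply: (perm_trans _ (perm_other_forms aA0)).
have : perm_eq (map (mulmx^~ A) nonzero_forms) ((a *m A) :: map (mulmx^~ A) (other_forms a)).
  exact: (perm_map (mulmx^~ A) (perm_other_forms a0)).
rewrite perm_sym => /perm_trans; apply; apply: uniq_perm.
- by rewrite (map_inj_uniq injA) uniq_nonzero_forms.
- exact: uniq_nonzero_forms.
have BA := mulmx1C AB.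
move=> b; rewrite mem_nonzero_forms; apply/mapP/idP => [[c c0 ->]|b0].
  by rewrite -(mul0mx _ A) (inj_eq injA) -mem_nonzero_forms.
exists (b *m B); last by rewrite -mulmxA BA mulmx1.
rewrite mem_nonzero_forms; apply: contra_neq b0 => bB.
by rewrite -[b]mulmx1 -BA mulmxA bB mul0mx.
Qed.

Section Degree.
Variable k : nat.
Hypothesis kE : k = (p ^ m).-2.*2.+1.
Local Notation HL := (cohomology (trivial_gmodule L F) k).

(* The derivation of F_p[y] with y_i |-> sum_j E_ij x_j, applied to the Dickson invariant
   c_(n,0), the product of all nonzero linear forms in the y_i. *)
Definition dickson_derivation (E : 'M[F]_m) : HL :=
  \sum_(a : 'rV[F]_m | a != 0)
    bar_class k (cup_monomial (linear_form (a *m E)) bockstein (other_forms a)).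

Lemma scocycle_monomial E a : a != 0 ->
  scocycle k (cup_monomial (linear_form E) bockstein (other_forms a)).
Proof.
move=> a0; rewrite kE -(size_other_forms a0).
exact: scocycle_cup_monomial (scocycle_linear_form _) scocycle_bockstein.
Qed.

Lemma dickson_derivationD E E' :
  dickson_derivation (E + E') = dickson_derivation E + dickson_derivation E'.
Proof.
rewrite /dickson_derivation -big_split; apply: eq_bigr => a a0 /=.
rewrite -bar_classD; try exact: scocycle_monomial.
apply: eq_bar_class => s _; rewrite -cup_monomialDl /cup_monomial.
by case: s => [//|u s] /=; rewrite mulmxDr mulmxDl mxD00.
Qed.

Lemma mxred1 l : mxred (1%:M : 'M[R]_l) = 1%:M.
Proof.
apply/matrixP => i j; rewrite !mxE; case: eqP => _ /=; last by [].
by rewrite -[zlift _]/(Posz _) -[(1%R : R) : nat]/1%N.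
Qed.

Lemma mxred_unit (g : {'GL_n[R]}) : mxred (GLval g) *m mxred (GLval g^-1%g) = 1%:M.
Proof.
rewrite -mxredM -mxred1; congr mxred.
by have := congr1 val (mulgV g).
Qed.

(** Pulling back along the inverse of [g] turns the form a into aB. Reindexing the sum by a |-> aB
    matches the degree-one factors, because (aB)(AEB) = aEB, and the remaining forms agree up to
    order. *)
Lemma dickson_derivation_act (g : {'GL_n[R]}) E :
  GL_gact g (dickson_derivation E) =
  dickson_derivation (mxred (GLval g) *m E *m mxred (GLval g^-1%g)).
Proof.
set A := mxred (GLval g); set B := mxred (GLval g^-1%g).
have AB : A *m B = 1%:M := mxred_unit g.
have BA := mulmx1C AB.
have injB : injective (mulmx^~ B : 'rV[F]_m -> 'rV[F]_m).
  by apply: (can_inj (g := mulmx^~ A)) => b; rewrite /= -mulmxA BA mulmx1.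
rewrite /GL_gact raddf_sum.
rewrite [RHS](reindex_inj injB) /=; apply: eq_big => [a|a a0].
  by rewrite -[in RHS](mul0mx _ B) (inj_eq injB).
have aB0 : a *m B != 0 by rewrite -(mul0mx _ B) (inj_eq injB).
rewrite [LHS]bar_class_pull; last exact: scocycle_monomial.
have kaE b : b != 0 -> k = (size (other_forms b)).*2.+1.
  by move=> b0; rewrite size_other_forms.
pose Y b := bockstein (b *m B).
have cY b : scocycle 2 (Y b) by exact: scocycle_bockstein.
have cYg b : scocycle 2 (bockstein b \o map (GL_mulv g^-1%g)).
  exact: scocycle_map (scocycle_bockstein b).
have cb := scocycle_bockstein.
have cX b : scocycle 1 (linear_form b) := scocycle_linear_form b.
transitivity (bar_class k (cup_monomial (linear_form (a *m E *m B)) Y (other_forms a))).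
  transitivity (bar_class k (cup_monomial (linear_form (a *m E *m B))
      (fun b => bockstein b \o map (GL_mulv g^-1%g)) (other_forms a))).
    apply: eq_bar_class => s _; rewrite /= cup_monomial_map /cup_monomial.
    case: s => [//|u s] /=; congr (_ * _).
    exact: (linear_form_map (a *m E) g^-1%g [:: u]).
  apply: bar_class_eq; rewrite ?kE // -kE (kaE a a0).
  - exact: scocycle_cup_monomial.
  - exact: scocycle_cup_monomial.
  by apply: cohomologous_cup_monomial => // b; apply: bockstein_map.
transitivity (bar_class k (cup_monomial (linear_form (a *m E *m B)) bockstein
    (map (mulmx^~ B) (other_forms a)))).
  apply: eq_bar_class => s szs; rewrite /cup_monomial; case: s szs => [//|u s] szs.
  apply: (@eq_cup _ _ 1) => // l; rewrite /= subSS subn0 => szl.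
  by apply: eq_cups => //; rewrite szl; move: szs; rewrite (kaE a a0) => -[].
have -> : a *m B *m (A *m E *m B) = a *m E *m B.
  by rewrite !mulmxA -[a *m B *m A]mulmxA BA mulmx1.
have pB := perm_other_forms_mul a0 BA.
have szB : size (map (mulmx^~ B) (other_forms a)) = size (other_forms a) by rewrite size_map.
apply: bar_class_eq; rewrite ?kE // -kE (kaE a a0) -szB.
- exact: scocycle_cup_monomial.
- by rewrite (perm_size pB); apply: scocycle_cup_monomial.
exact: cohomologous_cup_monomial_perm.
Qed.

End Degree.
End DicksonDifferential.

(** * Detection of the Dickson derivation *)

Section Periodic.
Variables (L : finGroupType) (F : comNzRingType) (t : L) (N : nat).

(** The differentials t - 1 and 1 + t + ... + t^(N-1) of the periodic resolution of a cyclic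
    group. *)
Definition periodic k : seq (F * L) :=
  if k is 0 then [::]
  else if odd k then [:: (1, t); (-1, 1%g)] else [seq (1, (t ^+ j)%g) | j <- iota 0 N].

Lemma mem_periodic k x : x \in periodic k -> exists j, x.2 = (t ^+ j)%g.
Proof.
case: k => [//|k]; rewrite /periodic; case: ifP => _.
  by rewrite !inE => /orP[] /eqP ->; [exists 1%N | exists 0%N].
by case/mapP => j _ ->; exists j.
Qed.

Lemma big_periodic_odd k (phi : F * L -> F) : odd k ->
  \sum_(x <- periodic k) phi x = phi (1, t) + phi (-1, 1%g).
Proof. by case: k => [//|k] ok; rewrite /periodic ok !big_cons big_nil addr0. Qed.

Lemma big_periodic_even k (phi : F * L -> F) : ~~ odd k -> (0 < k)%N ->
  \sum_(x <- periodic k) phi x = \sum_(j < N) phi (1, (t ^+ j)%g).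
Proof.
by case: k => [//|k] ok _; rewrite /periodic (negPf ok) big_map -[N in iota 0 N]subn0 big_mkord.
Qed.

Hypothesis tN : (t ^+ N = 1)%g.

Lemma periodic_mul k (phi : L -> F) :
  \sum_(x <- periodic k.+1) x.1 * \sum_(y <- periodic k) y.1 * phi (x.2 * y.2)%g = 0.
Proof.
have tele : \sum_(j < N) (phi (t ^+ j.+1)%g - phi (t ^+ j)%g) = 0.
  rewrite -(big_mkord xpredT (fun j => phi (t ^+ j.+1)%g - phi (t ^+ j)%g)).
  by rewrite telescope_sumr // tN expg0 subrr.
have [->|k0] := posnP k; first by rewrite big1 // => x _; rewrite big_nil mulr0.
case ok: (odd k).
  rewrite big_periodic_even /= ?ok // -[RHS]tele; apply: eq_bigr => j _.
  by rewrite big_periodic_odd //= mulg1 -expgSr; ring.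
rewrite big_periodic_odd /= ?ok // !big_periodic_even ?ok // -[RHS]tele sumrB /=.
rewrite mul1r mulN1r; congr (_ - _); apply: eq_bigr => j _.
  by rewrite mul1r expgS.
by rewrite mul1r mul1g.
Qed.

Lemma periodic_aug k : N%:R = 0 :> F -> \sum_(x <- periodic k) x.1 = 0.
Proof.
move=> N0; have [->|k0] := posnP k; first by rewrite big_nil.
case ok: (odd k); first by rewrite big_periodic_odd //= subrr.
by rewrite big_periodic_even ?ok // sumr_const card_ord.
Qed.

End Periodic.

(** * The value of the Dickson derivation on a shuffle cycle *)

Section DicksonValue.
Variables (p n r : nat) (F : finFieldType).
Hypotheses (charF : p \in [pchar F]) (cardF : #|F| = p) (r_gt1 : (1 < r)%N).
Local Notation q := (p ^ r)%N.
Local Notation R := 'Z_q.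
Local Notation L := (GL_vec R n).
Local Notation m := n.-1.+1.

Let r_gt0 : (0 < r)%N := ltnW r_gt1.
Let p_prime := pcharf_prime charF.
Let p_gt1 := prime_gt1 p_prime.
Let q_gt1 : (1 < q)%N.
Proof. by rewrite -{1}(exp1n r) ltn_exp2r // prime_gt1. Qed.

Definition axis_step (i : 'I_m) : nat := if i == ord0 then p else 1.
Definition axis_order (i : 'I_m) : nat := (q %/ axis_step i)%N.

(* The first axis is shrunk by p: [linear_form] then vanishes on it, and it is fixed by the
   matrices 1 + p^(r-1) delta_(max,0). *)
Definition axis (i : 'I_m) : L := ((axis_step i)%:R *: (delta_mx i 0 : 'cV[R]_m))%R.
Definition axes (i : 'I_m) (k : nat) : seq (F * L) := periodic F (axis i) (axis_order i) k.

Lemma axis_stepK i : (axis_order i * axis_step i)%N = q.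
Proof.
rewrite divnK // /axis_step; case: eqP => _; last exact: dvd1n.
exact: dvdn_exp.
Qed.

Lemma axisX i j : (axis i ^+ j)%g = ((j * axis_step i)%:R *: (delta_mx i 0 : 'cV[R]_m))%R :> 'cV[R]_m.
Proof.
elim: j => [|j IH]; first by rewrite expg0 mul0n scale0r.
by rewrite expgS [(_ * _)%g]/(_ + _) IH mulSn natrD scalerDl.
Qed.

Lemma axis_expg_order i : (axis i ^+ axis_order i = 1)%g.
Proof. by apply: (etrans (axisX _ _)); rewrite axis_stepK pchar_Zp // scale0r. Qed.

(** The shrunken first axis has order p^(r-1), still divisible by p because r > 1. *)
Lemma axis_order0 i : (axis_order i)%:R = 0 :> F.
Proof.
have : (p %| axis_order i)%N.
  rewrite /axis_order /axis_step; case: eqP => _; last by rewrite divn1 dvdn_exp.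
  by rewrite -{1}(prednK r_gt0) expnS mulKn ?(ltnW p_gt1) // dvdn_exp // -subn1 subn_gt0.
by rewrite (dvdn_pcharf charF) => /eqP.
Qed.

Lemma axes0 i : axes i 0 = [::]. Proof. by []. Qed.

Lemma axes_mul i k (phi : L -> F) :
  \sum_(x <- axes i k.+1) x.1 * \sum_(y <- axes i k) y.1 * phi (x.2 * y.2)%g = 0.
Proof. exact: periodic_mul (axis_expg_order i) _ _. Qed.

Lemma axes_aug i k : \sum_(x <- axes i k) x.1 = 0.
Proof. exact: periodic_aug _ (axis_order0 i). Qed.

Lemma axis_gt1 i : (1 < axis_order i)%N.
Proof.
have := axis_stepK i; rewrite /axis_step; case: eqP => _.
  have -> : (q = p ^ r.-1 * p)%N by rewrite mulnC -expnS prednK.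
  move/eqP; rewrite eqn_pmul2r ?(ltnW p_gt1) // => /eqP ->.
  by rewrite -{1}(exp1n r.-1) ltn_exp2r // -subn1 subn_gt0.
by rewrite muln1 => ->.
Qed.

Lemma val_axisX i j k : (j < axis_order i)%N ->
  ((axis i ^+ j)%g : 'cV[R]_m) k 0 = ((k == i) * (j * axis_step i))%N :> nat.
Proof.
move=> ltj; rewrite axisX !mxE eqxx andbT mulr_natr.
have lt_q : (j * axis_step i < q)%N.
  rewrite -[X in (_ < X)%N](axis_stepK i) ltn_pmul2r //.
  by rewrite /axis_step; case: eqP => // _; apply: ltnW.
by case: eqP => _; rewrite ?mulr1n ?mulr0n ?mul1n // val_Zp_nat // modn_small.
Qed.

Lemma axisX_off i j k : k != i -> ((axis i ^+ j)%g : 'cV[R]_m) k 0 = 0.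
Proof. by move=> ki; rewrite axisX !mxE (negPf ki) mulr0. Qed.

Lemma bocksteinE (a : 'rV[F]_m) (u v : L) :
  bockstein a [:: u; v] =
  \sum_k a 0 k * ((((u : 'cV[R]_m) k 0)%R + ((v : 'cV[R]_m) k 0)%R) %/ q)%N%:R.
Proof. by rewrite /= mxE; apply: eq_bigr => k _; rewrite mxE carryE. Qed.

Lemma bockstein_diff (a : 'rV[F]_m) i j k l x y : i != j -> x \in axes i k -> y \in axes j l ->
  bockstein a [:: x.2; y.2] = 0.
Proof.
move=> ij /mem_periodic[e ->] /mem_periodic[f ->].
rewrite bocksteinE big1 // => h _; have [hi|hi] := eqVneq h i.
  rewrite (@axisX_off j) ?hi // addn0 divn_small ?mulr0 //; exact: ltn_Zp.
rewrite (@axisX_off i) // add0n divn_small ?mulr0 //; exact: ltn_Zp.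
Qed.

(** Along an axis of order N, adding the generator to its j-th multiple with j < N carries only for
    j = N - 1. The step of the axis cancels against q, also on the first axis. *)
Lemma bockstein_same (a : 'rV[F]_m) i k : ~~ odd k ->
  \sum_(x <- axes i k.+2) x.1 * \sum_(y <- axes i k.+1) y.1 * bockstein a [:: x.2; y.2] = a 0 i.
Proof.
move=> ok; rewrite /axes big_periodic_even //; last by rewrite /= negbK.
transitivity (\sum_(j < axis_order i) a 0 i * (j.+1 %/ axis_order i)%N%:R).
  apply: eq_bigr => j _; rewrite big_periodic_odd // ![fst _]/= ![snd _]/= !mul1r.
  rewrite !bocksteinE [X in _ + -1 * X]big1 ?mulr0 ?addr0; last first.
    move=> h _; rewrite [X in (_ + X)%N](_ : _ = 0%N); last by rewrite mxE.
    rewrite addn0 divn_small ?mulr0 //; exact: ltn_Zp.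
  rewrite (bigD1 i) //= big1 ?addr0 => [|h hi]; last first.
    rewrite (@axisX_off i) // add0n divn_small ?mulr0 //; exact: ltn_Zp.
  rewrite val_axisX // -[axis i]expg1 val_axisX ?axis_gt1 // eqxx !mul1n.
  rewrite -mulSnr -[in LHS](axis_stepK i) divnMr //.
  by rewrite /axis_step; case: eqP => // _; apply: ltnW.
have := axis_gt1 i; case: (axis_order i) => // N N1.
rewrite big_ord_recr /= divnn /= mulr1 big1 ?add0r // => j _.
by rewrite divn_small ?mulr0 // ltnS.
Qed.

(** The default [ord0] is reached only by the zero form. *)
Definition lead (a : 'rV[F]_m) : 'I_m :=
  odflt ord0 [pick i | (a 0 i != 0) && [forall j : 'I_m, (j < i)%N ==> (a 0 j == 0)]].

Lemma lead_lt a (i : 'I_m) : (i < lead a)%N -> a 0 i = 0.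
Proof.
rewrite /lead; case: pickP => [j /andP[_ /forallP a0]|//] /= lti.
by apply/eqP; apply: implyP (a0 i) lti.
Qed.

Lemma lead_neq0 (a : 'rV[F]_m) : a != 0 -> a 0 (lead a) != 0.
Proof.
move=> a0; have [i ai] : exists i, a 0 i != 0.
  apply/existsP; apply: contraNT a0; rewrite negb_exists => /forallP a0.
  by apply/eqP/rowP => i; rewrite mxE; apply/eqP; have := a0 i; rewrite negbK.
rewrite /lead; case: pickP => [j /andP[]//|/= noj].
case: (arg_minnP (P := fun j : 'I_m => a 0 j != 0) (fun j : 'I_m => j : nat) ai) => j aj minj.
have := noj j; rewrite aj /= => /negbT /negP[]; apply/forallP => h.
by apply/implyP; apply: contraTT => /minj; rewrite -leqNgt.
Qed.

(* The exponent of the leading monomial of the Dickson invariant, divided by the last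
   variable. *)
Definition dickson_exp : {ffun 'I_m -> nat} := decr ord_max (lead_count lead (nonzero_forms n F)).

Lemma sum_lead_count ms : (\sum_i lead_count lead ms i)%N = size ms.
Proof.
elim: ms => [|a ms IH]; first by rewrite big1 // => i _; rewrite ffunE.
have a1 : (0 < lead_count lead (a :: ms) (lead a))%N by rewrite ffunE /= eqxx.
rewrite (sum_decr a1) /= -IH; congr _.+1; apply: eq_bigr => i _.
by rewrite !ffunE /= eq_sym addKn.
Qed.

Let last_form : 'rV[F]_m := delta_mx 0 ord_max.

Lemma lead_last_form c : c != 0 -> lead (c *: last_form) = ord_max.
Proof.
move=> c0; have cl0 : c *: last_form != 0.
  apply: contra_neq c0 => /rowP/(_ ord_max); rewrite !mxE !eqxx mulr1; exact.
apply: contra_neq_eq (lead_neq0 cl0) => ne.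
by rewrite !mxE (negPf ne) mulr0.
Qed.

(** Ensures that the truncated subtraction in [dickson_exp] really lowers the last exponent. *)
Lemma lead_count_last : (0 < lead_count lead (nonzero_forms n F) ord_max)%N.
Proof.
rewrite ffunE -has_count; apply/hasP; exists (1 *: last_form); last first.
  by rewrite lead_last_form ?oner_neq0.
rewrite mem_nonzero_forms; apply/eqP => /rowP/(_ ord_max).
by rewrite !mxE !eqxx mulr1 => /eqP; rewrite oner_eq0.
Qed.

(** If [a] leads with the last variable, [dickson_exp] is the leading exponent of the product of the
    other forms. Otherwise removing [a] lowers the least weight by less than removing the last
    variable does, so [dickson_exp] lies below every monomial of that product. *)
Lemma cup_coef_dickson_exp (a : 'rV[F]_m) : a != 0 ->
  a 0 ord_max * cup_coef axes (@bockstein p n r F) dickson_exp (other_forms a) =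
  if lead a == ord_max then \prod_(b <- nonzero_forms n F) b 0 (lead b) else 0.
Proof.
move=> a0; have pa := perm_other_forms a0.
have cE : lead_count lead (nonzero_forms n F) = lead_count lead (a :: other_forms a).
  by apply/ffunP => i; rewrite !ffunE; exact: (seq.permP pa).
have mu0 (b : 'rV[F]_m) (i : 'I_m) : (i < lead b)%N -> b 0 i = 0 by exact: lead_lt.
case: ifP => [/eqP la|/negbT la].
  rewrite (perm_big _ pa) big_cons /= la; congr (_ * _).
  have -> : dickson_exp = lead_count lead (other_forms a).
    by rewrite /dickson_exp cE; apply/ffunP => i; rewrite !ffunE /= la eq_sym addKn.
  exact: (cup_coef_lead axes0 bockstein_diff bockstein_same mu0).
rewrite (cup_coef_low axes0 bockstein_diff bockstein_same mu0) ?mulr0 //.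
have := weight_decr lead_count_last; rewrite -/dickson_exp cE weight_lead_count big_cons.
have : (lead a < m.-1)%N by rewrite ltn_neqAle -ltnS ltn_ord andbT.
by move=> /=; lia.
Qed.

Definition detect (U : seq L -> F) : F :=
  cell_eval axes (p ^ m).-2.*2.+1
    (Slant1 (delta_mx 0 0 : 'cV[R]_m), doublef dickson_exp) U.

Lemma cell_deg_detect (t : L) :
  cell_deg (Slant1 t, doublef dickson_exp) = (p ^ m).-2.*2.+1.
Proof.
rewrite /cell_deg /= add1n; congr _.+1.
have := sum_lead_count (nonzero_forms n F).
rewrite (sum_decr lead_count_last) (size_nonzero_forms n cardF) -/dickson_exp => <- /=.
rewrite -muln2 big_distrl; apply: eq_bigr => i _ /=; rewrite muln2; exact: ffunE.
Qed.

Lemma linear_form_delta (a : 'rV[F]_m) (u : L) :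
  linear_form (a *m delta_mx ord_max 0) [:: u] = a 0 ord_max * ((u : 'cV[R]_m) 0 0 : nat)%:R.
Proof.
rewrite /= -(mul_delta_mx (0 : 'I_1)) mulmxA -colE -mulmxA -rowE mxE big_ord1.
by rewrite !mxE.
Qed.

Lemma linear_form_axes (a : 'rV[F]_m) i l w : w \in axes i l ->
  linear_form (a *m delta_mx ord_max 0) [:: w.2] = 0.
Proof.
move=> /mem_periodic[j ->]; rewrite linear_form_delta.
suff /eqP-> : (((axis i ^+ j)%g : 'cV[R]_m) 0 0 : nat)%:R == 0 :> F by rewrite mulr0.
have [i0|i0] := eqVneq i 0; last by rewrite axisX_off // eq_sym.
rewrite -(dvdn_pcharf charF) i0 axisX !mxE !eqxx mulr1 val_Zp_nat //.
by rewrite /dvdn modn_dvdm ?dvdn_exp // /axis_step eqxx modnMl.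
Qed.

Lemma detect_monomial (a : 'rV[F]_m) : a != 0 ->
  detect (cup_monomial (linear_form (a *m delta_mx ord_max 0)) (@bockstein p n r F) (other_forms a)) =
  a 0 ord_max * cup_coef axes (@bockstein p n r F) dickson_exp (other_forms a).
Proof.
move=> a0; rewrite /detect (cell_eval_cup1 axes0).
- rewrite /cup_coef (size_other_forms cardF) //; congr (_ * _).
  by rewrite linear_form_delta !mxE /= mulr1.
- by rewrite linear_form_delta mxE mulr0.
- exact: linear_form_axes.
Qed.

Lemma eq_detect U V : (forall s, size s = (p ^ m).-2.*2.+1 -> U s = V s) ->
  detect U = detect V.
Proof. exact: (eq_cell_eval axes0). Qed.

Lemma detectB U V : detect (fun s => U s - V s) = detect U - detect V.
Proof. exact: (cell_evalB axes0). Qed.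

Let mulLC (x y : L) : (x * y = y * x)%g.
Proof. exact: addrC. Qed.

Lemma detect_scob U : detect (scob U) = 0.
Proof.
exact: (cell_eval_scob_slant1 mulLC axes0 axes_mul axes_aug _ (cell_deg_detect _)).
Qed.

Lemma detect_dickson :
  class_eval detect (dickson_derivation p r (p ^ m).-2.*2.+1 (delta_mx ord_max 0 : 'M[F]_m)) != 0.
Proof.
have evalD := class_evalD eq_detect detectB detect_scob.
have eval0 := class_eval0 eq_detect detectB detect_scob.
rewrite /dickson_derivation (big_morph _ evalD eval0).
pose P := \prod_(b <- nonzero_forms n F) b 0 (lead b).
have -> : \sum_(a : 'rV[F]_m | a != 0) class_eval detect
    (bar_class (p ^ m).-2.*2.+1 (cup_monomial (linear_form (a *m delta_mx ord_max 0))
       (@bockstein p n r F) (other_forms a))) =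
    \sum_(a : 'rV[F]_m | a != 0) if lead a == ord_max then P else 0.
  apply: eq_bigr => a a0; rewrite (class_eval_bar eq_detect detectB detect_scob).
    by rewrite detect_monomial // cup_coef_dickson_exp.
  exact: scocycle_monomial.
(* The forms leading with the last variable are the nonzero multiples of [last_form]. There are p -
   1 of them, each contributing [P], and p - 1 = -1 in [F]. *)
rewrite -big_mkcondr (reindex_onto (fun c => c *: last_form) (fun a => a 0 ord_max)) /=.
  rewrite (eq_bigl (fun c => c != 0)) => [|c].
    rewrite sumr_const cardC1 cardF -mulr_natr mulf_neq0 //.
      rewrite /P big_seq prodf_seq_neq0; apply/allP => b _; apply/implyP.
      by rewrite mem_nonzero_forms; apply: lead_neq0.
    by rewrite -subn1 natrB ?(ltnW p_gt1) // (pcharf0 charF) sub0r oppr_eq0 oner_neq0.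
  have -> : (c *: last_form) 0 ord_max = c by rewrite !mxE !eqxx mulr1.
  rewrite eqxx andbT; have [->|c0] := eqVneq c 0; first by rewrite scale0r eqxx.
  rewrite lead_last_form // eqxx andbT; apply/eqP => /rowP/(_ ord_max).
  by rewrite !mxE !eqxx mulr1 => /eqP; rewrite (negPf c0).
move=> a /andP[a0 /eqP la]; apply/rowP => i; rewrite !mxE eqxx /=.
have [->|ni] := eqVneq i ord_max; first by rewrite mulr1.
rewrite mulr0; apply/esym/lead_lt; rewrite la ltn_neqAle -ltnS ltn_ord andbT.
exact: ni.
Qed.

End DicksonValue.

(** * The extension class *)

Section LowDegreeCohomology.
Variables (G : finGroupType) (M : gmodule G).

Definition cochain2 (f : G -> G -> M) : cochain M 2 :=
  [ffun x : {ffun 'I_2 -> G} => f (x ord0) (x ord_max)].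

Lemma cochain2_cocycle f :
  (forall g h k, f (g * h)%g k + f g h = gmod_act g (f h k) + f g (h * k)%g) ->
  cochain2 f \in is_cocycle M 2.
Proof.
move=> cf; apply/eqP/ffunP => x; rewrite !ffunE !big_ord_recl big_ord0 /= !ffunE /=.
have -> : widen_ord (leqnSn 2) ord0 = ord0 by exact: val_inj.
have -> : widen_ord (leqnSn 2) ord_max = lift ord0 ord0 by exact: val_inj.
rewrite expr1 sqrrN expr1n exprS sqrrN expr1n mulr1 !mulrN1z mulr1z addr0.
by rewrite addrCA -cf addKr subrr.
Qed.

Lemma cochain2_class_neq0 f (cf : cochain2 f \in is_cocycle M 2) :
  (forall b : G -> M, ~ forall g h, f g h = gmod_act g (b h) - b (g * h)%g + b g) ->
  \pi_(cohomology M 2) (Cocycle cf) <> 0.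
Proof.
move=> nb E0.
have /asboolP /= [b bE] : Cocycle cf \in coboundaries M 2.
  have := Quotient.idealrBE (coboundaries M 2) (Cocycle cf) 0.
  by rewrite subr0 => ->; rewrite E0 raddf0.
pose b1 g := b [ffun=> g]; apply: (nb b1) => g h.
have := congr1 (fun c : cochain M 2 => c [ffun i => if i == ord0 then g else h]) bE.
rewrite /= !ffunE big_ord_recl big_ord0 /= => ->.
rewrite expr1 sqrrN expr1n mulrN1z mulr1z addr0.
by congr (gmod_act _ (b _) - b _ + b _); apply/ffunP => j; rewrite !ffunE ?ord1 /= ?ffunE.
Qed.

End LowDegreeCohomology.

Section ExtensionClass.
Variables (p n r : nat) (F : finFieldType).
Hypotheses (charF : p \in [pchar F]) (cardF : #|F| = p) (r_gt1 : (1 < r)%N).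
Hypothesis n_gt1 : (1 < n)%N.
Local Notation q := (p ^ r)%N.
Local Notation R := 'Z_q.
Local Notation L := (GL_vec R n).
Local Notation m := n.-1.+1.
Local Notation GL := {'GL_n[R]}.
Local Notation rd := (map_mx (intr : int -> F)).
Local Notation k := (p ^ m).-2.*2.+1.
Local Notation HL := (cohomology (trivial_gmodule L F) k).

Let r_gt0 : (0 < r)%N := ltnW r_gt1.
Let p_prime := pcharf_prime charF.
Let p_gt1 := prime_gt1 p_prime.
Let q_gt1 : (1 < q)%N.
Proof. by rewrite -{1}(exp1n r) ltn_exp2r // prime_gt1. Qed.

Definition GLred (g : GL) : 'M[F]_m := mxred F (GLval g).

Lemma GLredM g h : GLred (g * h)%g = GLred g *m GLred h.
Proof. exact: mxredM. Qed.

Lemma GLred1 : GLred 1%g = 1%:M.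
Proof. exact: mxred1. Qed.

(* The class of the extension of GL(n, Z/p^r) by M_n(F_p) given by GL(n, Z/p^(r+1)),
   in terms of the set-theoretic section lifting entries to {0, ..., p^r - 1}. *)
Definition extension_cocycle (g h : GL) : 'M[F]_m :=
  rd (mcarry (GLval g) (GLval h)) *m GLred (g * h)^-1%g.

(** Multiplying [mcarry_cocycle] on the right by the reduction of the inverse of ghk turns left
    multiplication by [g] into conjugation. *)
Lemma extension_cocycleP g h k :
  extension_cocycle (g * h)%g k + extension_cocycle g h =
  GLred g *m extension_cocycle h k *m GLred g^-1%g + extension_cocycle g (h * k)%g.
Proof.
have := congr1 (fun A => rd A *m GLred (g * h * k)^-1%g)
  (mcarry_cocycle q_gt1 (GLval g) (GLval h) (GLval k)).
rewrite /= !map_mxD !map_mxM -/(mxred F _) !mulmxDl -!mulmxA.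
rewrite -/(GLred k) -GLredM [in X in X + _](_ : (k * (g * h * k)^-1 = (g * h)^-1)%g); last first.
  by rewrite !invMg mulKVg.
rewrite addrC /extension_cocycle => E; apply: (etrans E); congr (_ + _).
  by rewrite !mulmxA -[RHS]mulmxA -GLredM -invMg !mulgA.
by rewrite mulgA.
Qed.

(** Only the slant generator of the cell moves under [g]; by additivity the factor u^p adds p times
    a value, which is 0 in [F]. *)
Lemma class_eval_detect_pull (g : GL) (x : HL) :
  (forall i l w, w \in @axes p n r F i l -> GL_mulv g w.2 = w.2) ->
  (exists u : L, GL_mulv g (delta_mx 0 0 : 'cV[R]_m) = ((delta_mx 0 0 : 'cV[R]_m) : L) * u ^+ p)%g ->
  class_eval (@detect p n r F) (cohomology_pull (GL_mulv g) x) = class_eval (@detect p n r F) x.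
Proof.
move=> g_axes [u gu]; have a0 := @axes0 p n r F.
have [U cU [-> ->]] := class_eval_pull (@eq_detect p n r F) (@detectB p n r F)
  (detect_scob charF cardF r_gt1) (GL_mulv g) x.
have mulLC (y z : L) : (y * z = z * y)%g by exact: addrC.
have evalM s t := cell_eval_slant1M mulLC a0 (axes_mul charF r_gt1) (axes_aug charF r_gt1)
  t cU (cell_deg_detect cardF s).
have eval1 : cell_eval (@axes p n r F) k (Slant1 (1%g : L), doublef (dickson_exp n F)) U = 0.
  by have /eqP := evalM 1%g 1%g; rewrite mulg1 -[X in X == _]addr0 (inj_eq (addrI _)) eq_sym => /eqP.
have evalX j : cell_eval (@axes p n r F) k (Slant1 (u ^+ j)%g, doublef (dickson_exp n F)) U =
    cell_eval (@axes p n r F) k (Slant1 u, doublef (dickson_exp n F)) U *+ j.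
  by elim: j => [|j IH]; rewrite ?expg0 // expgS evalM IH mulrS.
have g1 : GL_mulv g 1%g = 1%g by exact: mulmx0.
rewrite /detect (cell_eval_slant1_map a0 _ _ _ _ g1 g_axes).
by rewrite gu evalM evalX -[_ *+ p]mulr_natr (pcharf0 charF) mulr0 addr0.
Qed.

Lemma delta_sq0 (S : nzRingType) :
  (delta_mx ord_max 0 : 'M[S]_m) *m (delta_mx ord_max 0 : 'M[S]_m) = 0.
Proof.
apply: mul_delta_mx_0; rewrite -val_eqE /=; move: n_gt1; clear; case: n => [|[|]] //.
Qed.

Lemma exists_elementary (c : R) :
  exists g : GL, GLval g = 1%:M + c *: delta_mx ord_max 0.
Proof.
have U : (1%:M + c *: delta_mx ord_max 0 : 'M[R]_m) \in unitmx.
  have : (1%:M + c *: delta_mx ord_max 0 : 'M[R]_m) *m (1%:M - c *: delta_mx ord_max 0) = 1%:M.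
    rewrite mulmxDl !mulmxBr !mul1mx mulmx1 -scalemxAl -scalemxAr delta_sq0 !scaler0 subr0.
    by rewrite subrK.
  by case/mulmx1_unit.
by exists (FinRing.unit _ U).
Qed.

Lemma GLval_elementaryX (g : GL) c j : GLval g = 1%:M + c *: delta_mx ord_max 0 ->
  GLval (g ^+ j)%g = 1%:M + (c *+ j) *: delta_mx ord_max 0.
Proof.
move=> gE; elim: j => [|j IH]; first by rewrite expg0 GL_1E mulr0n scale0r addr0.
rewrite expgSr GL_MxE IH gE mulmxDl !mulmxDr !mul1mx mulmx1 -scalemxAl -scalemxAr.
by rewrite delta_sq0 !scaler0 addr0 mulrSr scalerDl addrAC addrA [_ + c *: _]addrC addrA.
Qed.

Lemma mxredMn a b (A : 'M[R]_(a, b)) j : mxred F (A *+ j) = mxred F A *+ j.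
Proof.
elim: j => [|j IH]; last by rewrite !mulrS (mxredD charF r_gt0) IH.
apply: (addrI (mxred F A)); rewrite -(mxredD charF r_gt0) !mulr0n.
by rewrite !addr0.
Qed.

Let c : R := (p ^ r.-1)%:R.

Let pc : (p ^ r.-1 * p)%N = q.
Proof. by rewrite mulnC -expnS prednK. Qed.

Let qR : q%:R = 0 :> R.
Proof. exact: pchar_Zp. Qed.

Section Elementary.
Variable g : GL.
Hypothesis gE : GLval g = 1%:M + c *: delta_mx ord_max 0.

Lemma elementary_order : (g ^+ p = 1)%g.
Proof.
apply: val_inj; apply: (etrans (GLval_elementaryX p gE)).
by rewrite -mulr_natr -natrM pc qR scale0r addr0.
Qed.

Lemma GLred_elementary j : GLred (g ^+ j)%g = 1%:M.
Proof.
have red_g : GLred g = 1%:M.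
  rewrite /GLred gE (mxredD charF r_gt0) mxred1 // /c.
  (* As r > 1, the entry p^(r-1) is divisible by p. *)
  have -> : r.-1 = r.-2.+1 by rewrite prednK // -subn1 subn_gt0.
  rewrite expnSr natrM mulr_natr -scalerMnl mxredMn -scaler_nat.
  by rewrite (pcharf0 charF) scale0r addr0.
elim: j => [|j IH]; first exact: GLred1.
by rewrite expgS GLredM red_g IH mul1mx.
Qed.

Lemma GLred_elementaryV j : GLred (g ^+ j)^-1%g = 1%:M.
Proof.
rewrite -[LHS]mul1mx -{1}(GLred_elementary j) -GLredM mulgV.
exact: GLred1.
Qed.

(** The matrix g - 1 kills e_2, ..., e_n and sends p e_1 to p^r e_n = 0; hence the factor p in the
    first axis. *)
Lemma elementary_axes i l w : w \in @axes p n r F i l -> GL_mulv g w.2 = w.2.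
Proof.
move=> /mem_periodic[j ->]; rewrite /GL_mulv axisX gE mulmxDl mul1mx.
rewrite -scalemxAl -scalemxAr mul_delta_mx_cond; have [i0|i0] := eqVneq 0 i.
  by rewrite mulr1n scalerA -natrM -i0 /axis_step eqxx mulnCA pc (natrM _ j q) qR mulr0 scale0r addr0.
by rewrite /= mulr0n !scaler0 addr0.
Qed.

Lemma elementary_first_axis : exists u : L,
  GL_mulv g (delta_mx 0 0 : 'cV[R]_m) = (((delta_mx 0 0 : 'cV[R]_m) : L) * u ^+ p)%g.
Proof.
(* g e_1 - e_1 = p^(r-1) e_n, divided by p. *)
exists ((p ^ r.-2)%:R *: delta_mx ord_max 0 : 'cV[R]_m).
have powE (u : 'cV[R]_m) j : ((u : L) ^+ j)%g = u *+ j :> 'cV[R]_m.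
  by elim: j => [//|j IH]; rewrite expgS mulrS -IH.
rewrite /GL_mulv gE mulmxDl mul1mx -scalemxAl mul_delta_mx.
apply: (congr1 (fun v : 'cV[R]_m => delta_mx 0 0 + v)); rewrite powE -scaler_nat scalerA.
by rewrite -natrM -expnS /c (@prednK r.-1) // -subn1 subn_gt0.
Qed.

Lemma class_eval_detect_elementary j (x : HL) :
  class_eval (@detect p n r F) (GL_gact (g ^+ j)%g x) = class_eval (@detect p n r F) x.
Proof.
elim: j x => [|j IH] x; first by rewrite expg0 GL_gact1.
rewrite expgS GL_gactM.
(* The fixed axes are known for [g], whereas [GL_gact g] pulls back along its inverse. A pullback
   along [g] is inserted, which then cancels the action. *)
have -> : class_eval (@detect p n r F) (GL_gact g (GL_gact (g ^+ j)%g x)) =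
    class_eval (@detect p n r F) (cohomology_pull (GL_mulv g) (GL_gact g (GL_gact (g ^+ j)%g x))).
  by rewrite class_eval_detect_pull //; [exact: elementary_axes | exact: elementary_first_axis].
rewrite -[X in cohomology_pull (GL_mulv X) _]invgK.
rewrite -[cohomology_pull _ _]/(GL_gact g^-1%g _) -GL_gactM mulVg GL_gact1.
exact: IH.
Qed.

Lemma mxlift_elementary j : (j < p)%N ->
  mxlift (GLval (g ^+ j)%g) = 1%:M + (j * p ^ r.-1)%N%:Z *: delta_mx ord_max 0.
Proof.
move=> ltj; rewrite (GLval_elementaryX j gE); apply/matrixP => i l; rewrite !mxE.
have max0 : (ord_max : 'I_m) != 0 by rewrite -val_eqE /=; move: n_gt1; clear; case: n => [|[|]].
have [->|il] := eqVneq i l.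
  have -> : (l == ord_max) && (l == 0) = false.
    by apply/negP => /andP[/eqP-> ]; apply/negP.
  by rewrite !mulr0 !addr0 (zlift_nat q_gt1 (k := 1)).
rewrite !add0r; case: andP => _; last by rewrite !mulr0 (zlift_nat q_gt1 (k := 0)) // ltnW.
rewrite !mulr1 /c -mulr_natl -natrM zlift_nat //.
by rewrite -pc mulnC ltn_pmul2l // expn_gt0 (ltnW p_gt1).
Qed.

(** The lifts multiply to 1 + (j+1) p^(r-1) e_(n,1), and division by p^r leaves the quotient of j+1
    by p. So only j = p - 1 contributes to the sum over the cyclic group. *)
Lemma extension_cocycle_elementary j : (j < p)%N ->
  extension_cocycle (g ^+ j)%g g = (j.+1 %/ p)%N%:R *: delta_mx ord_max 0.
Proof.
move=> ltj; rewrite /extension_cocycle -expgSr GLred_elementaryV mulmx1.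
have -> : mcarry (GLval (g ^+ j)%g) (GLval g) = (j.+1 %/ p)%N%:Z *: delta_mx ord_max 0.
  have := mxlift_elementary p_gt1; rewrite expg1 mul1n => lift_g.
  rewrite /mcarry mxlift_elementary // lift_g.
  rewrite mulmxDl !mulmxDr !mul1mx mulmx1 -scalemxAl -scalemxAr delta_sq0 !scaler0 addr0.
  rewrite -addrA -scalerDl -PoszD -mulSn; apply/matrixP => i l; rewrite !mxE.
  have [->|il] := eqVneq i l.
    have -> : (l == ord_max) && (l == 0) = false.
      apply/negP => /andP[/eqP-> ]; apply/negP.
      by rewrite -val_eqE /=; move: n_gt1; clear; case: n => [|[|]].
    by rewrite !mulr0 addr0 divz_small //= ltz_nat.
  rewrite add0r; case: andP => _; last by rewrite !mulr0 div0z.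
  by rewrite !mulr1 divz_nat -pc mulnC divnMl // expn_gt0 (ltnW p_gt1).
rewrite map_mxZ /= -pmulrn; congr (_ *: _).
exact: map_delta_mx.
Qed.

End Elementary.

Lemma dickson_extension_class_neq0 :
  exists x : cohomology (GL_cohomology R n F k) 2, x <> 0.
Proof.
pose D := @dickson_derivation p n r F k.
have DD : {morph D : A B / A + B} by apply: dickson_derivationD.
have cD : cochain2 (M := GL_cohomology R n F k) (fun g h => D (extension_cocycle g h))
    \in is_cocycle (GL_cohomology R n F k) 2.
  apply: cochain2_cocycle => g h l; rewrite -!DD extension_cocycleP DD; congr (_ + _).
  by apply/esym/dickson_derivation_act.
exists (\pi_(cohomology (GL_cohomology R n F k) 2) (Cocycle cD)).
apply: cochain2_class_neq0 => b bE.
have [g gE] := exists_elementary c.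
pose ev : HL -> F := class_eval (@detect p n r F).
have evB : {morph ev : x y / x - y}.
  exact: class_evalB (@eq_detect p n r F) (@detectB p n r F) (detect_scob charF cardF r_gt1).
have evD : {morph ev : x y / x + y}.
  exact: class_evalD (@eq_detect p n r F) (@detectB p n r F) (detect_scob charF cardF r_gt1).
have D0 : D 0 = 0 by apply: (addrI (D 0)); rewrite -DD !addr0.
have ev_act j x : ev (GL_gact (g ^+ j)%g x) = ev x.
  exact: class_eval_detect_elementary.
have : ev (D (delta_mx ord_max 0)) != 0 by exact: detect_dickson.
clearbody ev.
have -> : delta_mx ord_max 0 = \sum_(j < p) extension_cocycle (g ^+ j)%g g.
  rewrite (eq_bigr (fun j : 'I_p => (j.+1 %/ p)%N%:R *: delta_mx ord_max 0)) => [|j _]; last first.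
    exact: extension_cocycle_elementary.
  case: (p) p_gt1 => // p' p'_gt1; rewrite big_ord_recr /= divnn /= scale1r.
  by rewrite big1 ?add0r // => j _; rewrite divn_small ?scale0r // ltnS.
have ev0 : ev 0 = 0 by apply: (addrI (ev 0)); rewrite -evD !addr0.
rewrite (big_morph D DD D0) (big_morph ev evD ev0).
pose a j := ev (b (g ^+ j)%g).
(* The coboundary equation at the pair (g^j, g), with the action removed by invariance of [ev]. Over
   j < p the constant terms add up to p times [ev (b g)], which is 0, and the rest telescopes
   because g^p = 1. *)
rewrite (eq_bigr (fun j : 'I_p => ev (b g) - (a j.+1 - a j))) => [|j _]; last first.
  have -> : D (extension_cocycle (g ^+ j)%g g) = _ := bE (g ^+ j)%g g.
  rewrite evD evB -expgSr opprB addrAC addrA; congr (_ + _ - _).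
  exact: ev_act.
rewrite sumrB sumr_const card_ord -mulr_natr (pcharf0 charF) mulr0 sub0r.
rewrite -(big_mkord xpredT (fun j => a j.+1 - a j)) telescope_sumr // /a.
by rewrite (elementary_order gE) expg0 subrr oppr0 eqxx.
Qed.

End ExtensionClass.

Theorem corollary4p2p3 (p n r : nat) (p_prime : prime p) (n_ge2 : (2 <= n)%N)
    (r_large : (p = 2%N /\ (3 <= r)%N) \/ (odd p /\ (2 <= r)%N)) :
  exists x : cohomology
      (GL_cohomology 'Z_(p ^ r) n 'F_p (2 * p ^ n - 3)%N) 2,
    x <> 0%R.
Proof.
have r_gt1 : (1 < r)%N by case: r_large => [[_ /ltnW]|[]].
have -> : (2 * p ^ n - 3 = (p ^ n.-1.+1).-2.*2.+1)%N.
  rewrite prednK 1?ltnW //.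
  (* This bound keeps the truncated subtractions on both sides from bottoming out. *)
  have : (2 ^ 2 <= p ^ n)%N.
    by apply: (@leq_trans (p ^ 2)); [rewrite leq_exp2r ?prime_gt1 | rewrite leq_pexp2l ?prime_gt0].
  by case: (p ^ n)%N => [|[|a]] // _; rewrite !mulnS -mul2n.
exact: (@dickson_extension_class_neq0 p n r 'F_p (pchar_Fp p_prime) (card_Fp p_prime) r_gt1 n_ge2).
Qed.
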